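(* Let $\varphi$ be a primitive substitution of constant length $k\geq 2$ on a finite alphabet, and let $\lambda_s$ be its discrepancy rate. Then the amorphic complexity of $X_{\varphi}$ (exists and) is given by \[\mathrm{ac}(X_{\varphi})=\frac{\log k}{\log k-\log\lambda_s},\] with the conventions $-\log 0=\infty$, $\frac{\log k}{\infty}=0$ and $\frac{\log k}{0}=\infty$.
   Context: Substitutions. A substitution on a finite alphabet $\mathcal{A}$ is a map $\varphi\colon\mathcal{A}\to\mathcal{A}^*$ into finite words (possibly empty), extended by concatenation to words and to $\mathcal{A}^{\mathbf Z}$ via $\varphi(x)=\dots\varphi(x_{-1}).\varphi(x_0)\varphi(x_1)\dots$ (the dot marks position $0$). It has (constant) length $k$ if $|\varphi(a)|=k$ for all $a$; it is primitive if for some $n\ge1$ every $\varphi^n(a)$ contains every letter. Its incidence matrix is $M_\varphi=(|\varphi(b)|_a)_{a,b\in\mathcal A}$, where $|\varphi(b)|_a$ is the number of occurrences of $a$ in $\varphi(b)$. $X_\varphi\subseteq\mathcal{A}^{\mathbf Z}$ is the set of $x$ such that each finite word of $x$ appears in some $\varphi^n(a)$, $a\in\mathcal A$, $n\geq0$; it is considered with the left shift $T$. Height and pure base. Let $\varphi$ be primitive of length $k\ge2$ with a fixed point $x\in X_\varphi$ ($\varphi(x)=x$). The height of $\varphi$ is $h=\max\{n\geq1 : \gcd(n,k)=1 \text{ and } n \text{ divides } \gcd\{m\geq 1 : x_0=x_m\}\}$. The pure base of $\varphi$ is the substitution $\varphi'$ of length $k$ on the alphabet $\mathcal{A}'=\{x_{nh}x_{nh+1}\cdots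 x_{nh+h-1} : n\in\mathbf{Z}\}$ obtained by applying $\varphi$ to a word $w\in\mathcal{A}'$ and cutting the word $\varphi(w)$ of length $kh$ into $k$ consecutive words of length $h$. If $h=1$ then $\varphi'=\varphi$. Discrepancy substitution and rate. If $\varphi$ (on $\mathcal A$) has height $1$, let $\mathcal{A}_s$ be the set of unordered pairs $\binom{a}{b}=\binom{b}{a}$ of distinct letters of $\mathcal{A}$. Writing $\varphi(a)=a_0\dots a_{k-1}$ for $a\in\mathcal A$, the discrepancy substitution $\varphi_s\colon\mathcal{A}_s\to\mathcal{A}_s^*$ maps $\binom{a}{b}$ to the concatenation, in increasing order of $i$, of the letters $\binom{a_i}{b_i}$ over all $0\leq i<k$ with $a_i\neq b_i$ (the empty word if there is no such $i$). If $\varphi$ has height $>1$, $\varphi_s$ is defined as the discrepancy substitution of the pure base $\varphi'$. The discrepancy rate $\lambda_s$ of $\varphi$ is the dominant (Perron–Frobenius) eigenvalue, i.e. the spectral radius, of the incidence matrix of $\varphi_s$ ($\lambda_s=0$ if $\mathcal{A}_s=\emptyset$). If $\varphi$ has no fixed point in $X_\varphi$, choose $j\geq1$ such that $\varphi^j$ has a fixed point in $X_{\varphi^j}=X_\varphi$ and let $\lambda_s$ be the $j$-th root of the discrepancy rate of $\varphi^j$ (a substitution of length $k^j$); this does not depend on $j$. Amorphic complexity. Metrize $\mathcal{A}^{\mathbf Z}$ by $d(x,y)=\beta^{-j}$, $j=\min\{|\ell| : x_\ell\neq y_\ell\}$, for a fixed $\beta>1$. For $\delta>0$, $\nu\in(0,1]$,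 points $x,y\in X_\varphi$ are $(\delta,\nu)$-separated if the set $E=\{\ell\in\mathbf{Z} : d(T^\ell x,T^\ell y)\geq\delta\}$ satisfies $\limsup_{n\to\infty}\frac{|E\cap[-n,n]|}{2n+1}\geq\nu$. Let $\mathrm{Sep}(\delta,\nu)\in\mathbf N\cup\{\infty\}$ be the supremum of the cardinalities of subsets of $X_\varphi$ all of whose pairs of distinct points are $(\delta,\nu)$-separated. Put $\underline{\mathrm{ac}}(X_\varphi)=\sup_{\delta>0}\liminf_{\nu\to0}\frac{\log\mathrm{Sep}(\delta,\nu)}{-\log\nu}$ and $\overline{\mathrm{ac}}(X_\varphi)=\sup_{\delta>0}\limsup_{\nu\to0}\frac{\log\mathrm{Sep}(\delta,\nu)}{-\log\nu}$, in $[0,\infty]$ (both $\infty$ if some $\mathrm{Sep}(\delta,\nu)$ is infinite). If they coincide, the amorphic complexity $\mathrm{ac}(X_\varphi)$ exists and is their common value. *)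

(* Defs.v *)
From HB Require Import structures.
From mathcomp Require Import all_boot all_order all_algebra.
From mathcomp Require Import complex zify.
From mathcomp Require Import all_classical all_reals all_analysis.

Set Implicit Arguments.
Unset Strict Implicit.
Unset Printing Implicit Defensive.

Import Order.TTheory GRing.Theory Num.Theory.
Import numFieldNormedType.Exports.

Local Open Scope classical_set_scope.
Local Open Scope ring_scope.

Section Substitutions.
Variable A : finType.
Implicit Types (phi : A -> seq A) (x : int -> A) (k h : nat).

Definition subst_word phi (w : seq A) : seq A := flatten (map phi w).

Definition subst_pow phi (n : nat) (a : A) : seq A :=
  iter n (subst_word phi) [:: a].

Definition constant_length k phi := forall a, size (phi a) = k.

Definition primitive phi :=
  exists2 n : nat, (0 < n)%N & forall a b, b \in subst_pow phi n a.

(* For phi of constant length k, the word phi(x_q) occupies the positions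
   k q, ..., k q + k - 1 of phi(x); [%/] and [%%] on [int] are floor division
   and nonnegative remainder. *)
Definition subst_biinfinite k phi x : int -> A :=
  fun n => nth (x 0) (phi (x (n %/ k%:Z)%Z)) `|(n %% k%:Z)%Z|%N.

Definition factor x (i : int) (n : nat) : seq A :=
  [seq x (i + t%:Z) | t <- iota 0 n].

Definition subshift phi : set (int -> A) :=
  [set x | forall i n, exists a m, infix (factor x i n) (subst_pow phi m a)].

Definition fixed_point k phi x :=
  subshift phi x /\ subst_biinfinite k phi x = x.

Definition is_gcd (S : set nat) (g : nat) :=
  (forall m, S m -> (g %| m)%N) /\
  (forall d, (forall m, S m -> (d %| m)%N) -> (d %| g)%N).

Definition is_height k x h :=
  exists2 g, is_gcd [set m | (1 <= m)%N /\ x 0 = x m%:Z] g &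
    let H := [set n | [/\ (1 <= n)%N, gcdn n k = 1%N & (n %| g)%N]] in
    H h /\ forall n, H n -> (n <= h)%N.

Definition block x h (n : int) : h.-tuple A :=
  [tuple x (n * h%:Z + r%:Z) | r < h].

Definition base_alphabet x h : {set h.-tuple A} :=
  [set w | `[< exists n, w = block x h n >]].

(* When x is a fixed point of phi, the k words of length h cut from phi(w) are
   all in [base_alphabet x h], so [pmap insub] drops none of them: see
   [pure_baseE] below. *)
Definition pure_base k phi x h (w : {w | w \in base_alphabet x h}) :
    seq {w | w \in base_alphabet x h} :=
  pmap insub
    [seq [tuple nth (x 0) (subst_word phi (val w)) (i * h + r) | r < h]
    | i <- iota 0 k].

Notation upair := {p : {set A} | #|p| == 2%N}.

(* [insub [set a_i; b_i]] is [None] exactly when a_i = b_i. *)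
Definition discrepancy_word (u v : seq A) : seq upair :=
  pmap (fun c => insub [set c.1; c.2]%SET) (zip u v).

Definition discrepancy phi (p : upair) : seq upair :=
  if enum (val p) is [:: a; b] then discrepancy_word (phi a) (phi b) else [::].

End Substitutions.

Section DiscrepancyRate.
Variable R : realType.

Definition incidence_mx (B : finType) (psi : B -> seq B) : 'M[R]_#|B| :=
  \matrix_(i, j) (count_mem (enum_val i) (psi (enum_val j)))%:R.

(* The modulus is maximised over complex eigenvalues; for n = 0 there is none,
   and [sup set0 = 0]. *)
Definition spectral_radius n (M : 'M[R]_n) : R :=
  sup [set ComplexField.Normc.normc z
      | z in [set z | eigenvalue (map_mx (real_complex R) M) z]].

Definition discrepancy_rate1 (B : finType) (psi : B -> seq B) : R :=
  spectral_radius (incidence_mx (discrepancy psi)).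

Definition discrepancy_rate_at (A : finType) k (phi : A -> seq A) x h : R :=
  if h == 1%N then discrepancy_rate1 phi
  else discrepancy_rate1 (@pure_base A k phi x h).

(* A relation, because of the choices of the exponent j (which is 1 as soon as
   phi itself has a fixed point) and of the fixed point x of phi^j. Such choices
   always exist: see [discrepancy_rate_exists] below. *)
Definition is_discrepancy_rate (A : finType) k (phi : A -> seq A) (lam : R) :=
  exists (j : nat) (x : int -> A) (h : nat),
    [/\ (1 <= j)%N,
        (exists y, fixed_point k phi y) -> j = 1%N,
        fixed_point (k ^ j)%N (subst_pow phi j) x,
        is_height (k ^ j)%N x h &
        lam = discrepancy_rate_at (k ^ j)%N (subst_pow phi j) x h
                `^ (j%:R^-1)].

End DiscrepancyRate.

Section AmorphicComplexity.
Variables (R : realType) (A : finType) (beta : R).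
Implicit Types (x y : int -> A) (X : set (int -> A)).

Definition shift_pow (l : int) x : int -> A := fun i => x (i + l).

Definition disagree_at x y (n : nat) : bool :=
  `[< exists l : int, `|l|%N = n /\ x l <> y l >].

Definition shift_dist x y : R :=
  if pselect (exists n, disagree_at x y n) is left ex then beta ^- ex_minn ex
  else 0.

Definition upper_density (E : set int) : \bar R :=
  limn_esup (fun n : nat =>
    (counting (E `&` [set l : int | (- n%:Z <= l <= n%:Z)%R]) /
     (2 * n + 1)%:R%:E)%E).

Definition dnu_separated (delta nu : R) x y :=
  (nu%:E <= upper_density
              [set l : int | (delta <= shift_dist (shift_pow l x) (shift_pow l y))%R])%E.

Definition Sep X (delta nu : R) : \bar R :=
  ereal_sup [set counting S | S in [set S | S `<=` X /\
    forall x y, S x -> S y -> x <> y -> dnu_separated delta nu x y]].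

Definition log_ratio X (delta nu : R) : \bar R :=
  (lne (Sep X delta nu) / (- ln nu)%:E)%E.

Definition lower_ac X : \bar R :=
  ereal_sup [set limf_einf (log_ratio X delta) (at_right 0)
            | delta in [set delta : R | 0 < delta]].

Definition upper_ac X : \bar R :=
  ereal_sup [set limf_esup (log_ratio X delta) (at_right 0)
            | delta in [set delta : R | 0 < delta]].

Definition has_amorphic_complexity X (v : \bar R) :=
  lower_ac X = v /\ upper_ac X = v.

End AmorphicComplexity.

Section Specifications.
Variable A : finType.
Implicit Types (phi : A -> seq A) (x : int -> A) (k h : nat).
Lemma size_subst_word k phi w : constant_length k phi ->
  size (subst_word phi w) = (size w * k)%N.
Proof.
by move=> hk; elim: w => //= a w IH; rewrite size_cat hk IH mulSn.
Qed.

Lemma nth_subst_word k phi w d m : constant_length k phi -> (m < size w * k)%N ->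
  nth d (subst_word phi w) m = nth d (phi (nth d w (m %/ k))) (m %% k).
Proof.
move=> hk; elim: w m => [|a w IH] m; first by rewrite mul0n.
rewrite /= nth_cat hk mulSn => hm; case: ltnP => km.
  by rewrite divn_small// modn_small.
have k0 : (0 < k)%N by case: k {IH} hk hm km => //= _; rewrite muln0.
rewrite IH; last by lia.
rewrite -{3 4}(subnK km) divnDr// divnn k0 addn1 /=.
by rewrite modnDr.
Qed.

Lemma pure_baseE k phi x h n (w : {w | w \in base_alphabet x h}) :
  (0 < k)%N -> constant_length k phi -> subst_biinfinite k phi x = x ->
  val w = block x h n ->
  [seq val v | v <- pure_base k phi w] =
  [seq block x h (n * k%:Z + i%:Z) | i <- iota 0 k].
Proof.
move=> k0 hk fx wE; rewrite /pure_base.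
have -> : [seq [tuple nth (x 0) (subst_word phi (val w)) (i * h + r) | r < h]
    | i <- iota 0 k] = [seq block x h (n * k%:Z + i%:Z) | i <- iota 0 k].
  apply/eq_in_map => i; rewrite mem_iota add0n => /andP[_ ik].
  apply: eq_from_tnth => r; rewrite !tnth_mktuple wE.
  have rh := ltn_ord r.
  have mlt : (i * h + r < h * k)%N by nia.
  rewrite (nth_subst_word _ hk) ?size_tuple//.
  have dlt : ((i * h + r) %/ k < h)%N by rewrite ltn_divLR.
  rewrite -[in RHS]fx /subst_biinfinite.
  have -> : nth (x 0) (block x h n) ((i * h + r) %/ k)%N =
    x (n * h%:Z + ((i * h + r) %/ k)%N%:Z).
    by rewrite -(tnth_nth (x 0) _ (Ordinal dlt)) tnth_mktuple.
  have -> : (n * k%:Z + i%:Z) * h%:Z + r%:Z = (n * h%:Z) * k%:Z + (i * h + r)%N%:Z.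
    by rewrite PoszD PoszM mulrDl addrA mulrAC.
  by rewrite divzMDl ?modzMDl ?divz_nat ?modz_nat//; lia.
rewrite pmap_filter; last exact: insubK.
apply/all_filterP/allP => v /mapP[i _ ->]; rewrite isSome_insub inE.
by apply/asboolP; eexists.
Qed.

Lemma discrepancyE phi a b (p : {p : {set A} | #|p| == 2%N}) :
  val p = [set a; b]%SET -> discrepancy phi p = discrepancy_word (phi a) (phi b).
Proof.
have sym u v : @discrepancy_word A u v = discrepancy_word v u.
  rewrite /discrepancy_word; elim: u v => [|c u IH] [|d v] //=.
  by rewrite IH finset.setUC.
move=> pE; rewrite /discrepancy.
have := cardE (val p); rewrite (eqP (valP p)).
have := enum_uniq (mem (val p)); have := mem_enum (mem (val p)).
case: (enum _) => [|c [|d [|? ?]]] //= hm hu _.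
have := hm a; have := hm b; have := hm c; have := hm d.
rewrite pE !inE !eqxx !orbT /= => /esym/orP hd /esym/orP hc _ _.
case: hd hc hu => /eqP-> [] /eqP->; rewrite !inE ?eqxx//= => _.
Qed.
End Specifications.

Section Existence.
Variable A : finType.
Implicit Types (phi psi : A -> seq A) (x : int -> A) (k h : nat).
Local Open Scope nat_scope.

Lemma iter_subst_cat phi j u v :
  iter j (subst_word phi) (u ++ v) =
  iter j (subst_word phi) u ++ iter j (subst_word phi) v.
Proof. by elim: j => //= j ->; rewrite /subst_word map_cat flatten_cat. Qed.

Lemma subst_word_pow phi j w :
  subst_word (subst_pow phi j) w = iter j (subst_word phi) w.
Proof.
elim: w => [|a w IH]; first by elim: j => //= j <-.
by rewrite -cat1s iter_subst_cat -IH.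
Qed.

Lemma iter_subst_pow phi j n w :
  iter n (subst_word (subst_pow phi j)) w = iter (n * j) (subst_word phi) w.
Proof. by elim: n => //= n ->; rewrite subst_word_pow mulSn iterD. Qed.

Lemma size_iter k phi n w : constant_length k phi ->
  size (iter n (subst_word phi) w) = size w * k ^ n.
Proof.
move=> hk; elim: n => [|n IH] /=; first by rewrite muln1.
by rewrite (size_subst_word _ hk) IH expnSr mulnA.
Qed.

Lemma constant_length_pow k phi j : constant_length k phi ->
  constant_length (k ^ j) (subst_pow phi j).
Proof. by move=> hk a; rewrite (size_iter _ _ hk) mul1n. Qed.

(* The right-infinite limit of psi^n(c), when psi(c) starts with c. *)
Definition rlim psi c m := nth c (iter m.+1 (subst_word psi) [:: c]) m.

Section RightLimit.
Variables (K : nat) (psi : A -> seq A) (c : A).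
Hypotheses (K2 : 2 <= K) (hK : constant_length K psi).
Hypothesis hc : nth c (psi c) 0 = c.

Lemma rlim_step N m : m < K ^ N -> 
  nth c (iter N.+1 (subst_word psi) [:: c]) m = nth c (iter N (subst_word psi) [:: c]) m.
Proof.
elim: N m => [|N IH] m hm.
  by move: hm; case: m => //= _; rewrite /subst_word /= cats0 hc.
have lt1 : m %/ K < K ^ N by rewrite ltn_divLR -?expnSr//; lia.
rewrite iterS (nth_subst_word _ hK); last first.
  by rewrite (size_iter _ _ hK) mul1n expnS; move: hm; rewrite expnS; nia.
rewrite IH // [in RHS]iterS (nth_subst_word _ hK) //.
by rewrite (size_iter _ _ hK) mul1n -expnSr.
Qed.

Lemma rlimE N m : m < K ^ N -> nth c (iter N (subst_word psi) [:: c]) m = rlim psi c m.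
Proof.
move=> hN; have hm : m < K ^ m.+1 by apply: leq_trans (ltn_expl m K2) _; rewrite leq_exp2l.
have H N1 e : m < K ^ N1 -> nth c (iter (e + N1) (subst_word psi) [:: c]) m =
   nth c (iter N1 (subst_word psi) [:: c]) m.
  move=> h1; elim: e => // e IH; rewrite addSn rlim_step //.
  by apply: leq_trans h1 _; rewrite leq_exp2l ?leq_addl.
rewrite /rlim; case: (leqP N m.+1) => h.
  by rewrite -(subnK h) H.
by rewrite -(subnK (ltnW h)) H.
Qed.

Lemma rlim_fix m d : rlim psi c m = nth d (psi (rlim psi c (m %/ K))) (m %% K).
Proof.
have hm : m < K ^ m.+1 by apply: leq_trans (ltn_expl m K2) _; rewrite leq_exp2l.
rewrite /rlim iterS (nth_subst_word _ hK); last first.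
  by rewrite (size_iter _ _ hK) mul1n -expnSr.
rewrite rlimE; last by rewrite ltn_divLR -?expnSr//; lia.
by apply: set_nth_default; rewrite hK ltn_mod; lia.
Qed.
End RightLimit.

Definition rsub psi a := rev (psi a).

Lemma rev_iter psi n w : rev (iter n (subst_word psi) w) = iter n (subst_word (rsub psi)) (rev w).
Proof.
elim: n => //= n <-; by rewrite {1}/subst_word rev_flatten -map_comp -map_rev.
Qed.

(* The limit of psi^n(b) . psi^n(c). *)
Definition bilim psi b c (n : int) : A :=
  match n with Posz m => rlim psi c m | Negz m => rlim (rsub psi) b m end.

Section TwoSidedLimit.
Variables (K : nat) (psi : A -> seq A) (b c : A).
Hypotheses (K2 : 2 <= K) (hK : constant_length K psi).
Hypotheses (hb : last b (psi b) = b) (hc : head c (psi c) = c).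

Let hrK : constant_length K (rsub psi). Proof. by move=> a; rewrite size_rev. Qed.
Let hc' : nth c (psi c) 0 = c. Proof. by rewrite nth0. Qed.
Let hb' : nth b (rsub psi b) 0 = b.
Proof. by rewrite nth_rev ?hK; [rewrite subn1 -(hK b) nth_last | lia]. Qed.

Lemma bilim_fix : subst_biinfinite K psi (bilim psi b c) = bilim psi b c.
Proof.
apply/funext => -[m|m]; rewrite /subst_biinfinite.
  rewrite divz_nat modz_nat absz_nat /= [RHS](rlim_fix K2 hK hc' m c).
  by apply: set_nth_default; rewrite hK ltn_mod; lia.
have mK : m %% K < K by rewrite ltn_mod; lia.
have sK : K - 1 - m %% K < K by lia.
have eqn : Negz m = (Negz (m %/ K) * K%:Z + (K - 1 - m %% K)%N%:Z)%R.
  rewrite !NegzE; move: (divn_eq m K) mK; move: (m %/ K) (m %% K) => q r ->; lia.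
have -> : (Negz m %/ K%:Z)%Z = Negz (m %/ K).
  by rewrite {1}eqn divzMDl ?divz_nat ?(divn_small sK) ?addr0//; lia.
have -> : `|(Negz m %% K%:Z)%Z|%N = K - 1 - m %% K.
  by rewrite {1}eqn modzMDl modz_nat (modn_small sK).
rewrite /= [RHS](rlim_fix K2 hrK hb' m (bilim psi b c 0)) /rsub nth_rev hK//.
by congr nth; lia.
Qed.

Lemma bilim_window N t : t < 2 * K ^ N ->
  nth c (iter N (subst_word psi) [:: b; c]) t = bilim psi b c (t%:Z - (K ^ N)%N%:Z)%R.
Proof.
move=> ht; rewrite -(cat1s b) iter_subst_cat nth_cat (size_iter _ _ hK) mul1n.
case: ltnP => h.
  rewrite (_ : (_ - _)%R = Negz (K ^ N - t.+1)); last by rewrite NegzE; lia.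
  rewrite /= -(rlimE K2 hrK hb' (N:=N)); last by lia.
  rewrite -[[:: b]]/(rev [:: b]) -rev_iter nth_rev (size_iter _ _ hK) mul1n; last by lia.
  rewrite subnSK// subKn; last by lia.
  by apply: set_nth_default; rewrite (size_iter _ _ hK) mul1n.
rewrite (_ : (_ - _)%R = Posz (t - K ^ N)); last by lia.
by rewrite /= -(rlimE K2 hK hc' (N:=N))//; lia.
Qed.

Lemma bilim_factor i n : exists N0, forall N, N0 <= N ->
  infix (factor (bilim psi b c) i n) (iter N (subst_word psi) [:: b; c]).
Proof.
exists (`|i| + n) => N hN.
have hp : (`|i| + n < K ^ N)%N by exact: leq_ltn_trans hN (ltn_expl _ K2).
suff -> : factor (bilim psi b c) i n =
   take n (drop `|(i + (K ^ N)%N%:Z)%R| (iter N (subst_word psi) [:: b; c])).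
  exact: infix_trans (infix_take _ _) (infix_drop _ _).
have sz : size (iter N (subst_word psi) [:: b; c]) = 2 * K ^ N by rewrite (size_iter _ _ hK).
have s1 : size (factor (bilim psi b c) i n) = n by rewrite size_map size_iota.
apply: (@eq_from_nth _ c).
  rewrite s1 size_takel// size_drop sz; lia.
rewrite s1 => t tn; rewrite nth_take// nth_drop bilim_window; last by lia.
rewrite (nth_map 0) ?size_iota// nth_iota// add0n; congr bilim; lia.
Qed.
End TwoSidedLimit.

Lemma infix_subst phi j u v : infix u v ->
  infix (iter j (subst_word phi) u) (iter j (subst_word phi) v).
Proof.
by move=> /infixP[p [q ->]]; rewrite !iter_subst_cat; apply/infixP; do 2!eexists.
Qed.

Lemma primitive_ge phi : primitive phi -> exists n0, forall n, n0 <= n ->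
  forall a b, b \in subst_pow phi n a.
Proof.
case=> n n0 hn; exists n => m /subnK <- a b; elim: (m - n)%N b => [|e IH] b; first exact: hn.
have [d hd] : exists d, b \in phi d.
  have := hn b b; rewrite /subst_pow; case: n n0 {hn IH} => // n _ /=.
  by rewrite /subst_word => /flattenP[_ /mapP[d _ ->] ?]; exists d.
rewrite addSn /subst_pow /=; apply/flattenP; exists (phi d) => //.
apply: map_f.
exact: IH.
Qed.

Lemma height_exists K x m : 0 < m -> x 0%R = x m%:Z -> exists h, is_height K x h.
Proof.
move=> m0 xm; pose S := [set m | 1 <= m /\ x 0%R = x m%:Z].
pose P d := `[< forall m, S m -> (d %| m)%N >].
pose g := \big[lcmn/1]_(d < m.+1 | P d) d.
have Sm : S m by [].
have gS n : S n -> g %| n by move=> Sn; apply/dvdn_biglcmP => d /asboolP; apply.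
have gm : g <= m by apply: dvdn_leq (gS _ Sm).
have g0 : 0 < g by move: (gS _ Sm); case: (g) => //; rewrite dvd0n; lia.
pose H n := [&& 1 <= n, gcdn n K == 1 & n %| g].
have exH : exists n, H n by exists 1; rewrite /H gcd1n dvd1n.
have ubH n : H n -> n <= g by case/and3P => _ _; exact: dvdn_leq.
exists (ex_maxn exH ubH), g; first split=> // d hd.
  have dm : d < m.+1 by rewrite ltnS; apply: dvdn_leq (hd _ Sm).
  by apply: (biglcmn_sup (Ordinal dm)) => //=; apply/asboolP.
case: ex_maxnP => h /and3P[h1 /eqP h2 h3] hmax; split; first by [].
by move=> n [n1 n2 n3]; apply: hmax; rewrite /H n1 n2 n3 eqxx.
Qed.

Lemma fixed_height K psi x : 2 <= K -> constant_length K psi -> primitive psi -> fixed_point K psi x ->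
  exists h, is_height K x h.
Proof.
move=> K2 hK [n n0 hn] [_ fx].
have H N q t : t < K ^ N -> x (q * (K ^ N)%N%:Z + t%:Z)%R = nth (x 0%R) (subst_pow psi N (x q)) t.
  elim: N t => [|N IH] t ht.
    by move: ht; case: t => //= _; rewrite mulr1 addr0.
  have lt1 : t %/ K < K ^ N by rewrite ltn_divLR -?expnSr//; lia.
  rewrite /subst_pow iterS (nth_subst_word _ hK); last first.
    by rewrite (size_iter _ _ hK) mul1n -expnSr.
  rewrite -[iter N _ _]/(subst_pow psi N (x q)) -IH // -[in LHS]fx /subst_biinfinite.
  have -> : (q * (K ^ N.+1)%N%:Z + t%:Z = (q * (K ^ N)%N%:Z) * K%:Z + t%:Z)%R.
    by rewrite expnSr PoszM mulrA.
  by rewrite divzMDl ?modzMDl ?divz_nat ?modz_nat//; lia.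
have /(nthP (x 0%R)) [t] := hn (x 1%R) (x 0%R).
rewrite (constant_length_pow n hK) => ht ht2.
apply: (@height_exists K x (K ^ n + t)); first by rewrite addn_gt0 expn_gt0; lia.
by rewrite -ht2 -H// mul1r PoszD.
Qed.

Lemma primitive_pow phi j : 0 < j -> primitive phi -> primitive (subst_pow phi j).
Proof.
move=> j0 /primitive_ge[n0 hn]; exists n0.+1 => // a b.
by rewrite /subst_pow iter_subst_pow; apply: hn; nia.
Qed.

Definition lstep phi (p : A * A) := (last p.1 (phi p.1), head p.2 (phi p.2)).

Lemma periodic_point phi k : 2 <= k -> constant_length k phi -> primitive phi -> (exists a : A, True) ->
  exists j x, 0 < j /\ fixed_point (k ^ j) (subst_pow phi j) x.
Proof.
move=> k2 hk hp [a _].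
have ne c : 0 < size (phi c) by rewrite hk; lia.
have lp n p : (last p.1 (subst_pow phi n p.1), head p.2 (subst_pow phi n p.2)) = iter n (lstep phi) p.
  elim: n => [|n IH]; first by case: p.
  rewrite iterS -IH /lstep /=; set u := subst_pow phi n p.1; set v := subst_pow phi n p.2.
  have su : 0 < size u by rewrite (constant_length_pow n hk) expn_gt0; lia.
  have sv : 0 < size v by rewrite (constant_length_pow n hk) expn_gt0; lia.
  congr pair; rewrite /subst_pow /=.
    rewrite -/(subst_pow phi n p.1) -/u; case/lastP: u su => // u e _.
    rewrite last_rcons /subst_word map_rcons flatten_rcons last_cat.
    by case: (phi e) (ne e).
  rewrite -/(subst_pow phi n p.2) -/v; case: v sv => // e v _ /=.
  by rewrite /subst_word /=; case: (phi e) (ne e).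
have adm p m : infix [:: p.1; p.2] (subst_pow phi m a) ->
   infix [:: (lstep phi p).1; (lstep phi p).2] (subst_pow phi m.+1 a).
  move=> h; apply: infix_trans (infix_subst phi 1 h).
  rewrite /= /subst_word /= cats0 /lstep /=.
  case/lastP: (phi p.1) (ne p.1) => // u e _; case: (phi p.2) (ne p.2) => // d v _.
  by rewrite last_rcons -cats1 -catA; exact: infix_infix.
have [p0 hp0] : exists p0 : A * A, infix [:: p0.1; p0.2] (subst_pow phi 1 a).
  rewrite /subst_pow /= /subst_word /= cats0; move: (hk a).
  case: (phi a) => [|b [|c s]] /=; [lia|lia|].
  by exists (b, c); exact: (prefix_infix [:: b; c]).
have admi i : infix [:: (iter i (lstep phi) p0).1; (iter i (lstep phi) p0).2] (subst_pow phi i.+1 a).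
  elim: i => [|i IH]; [exact: hp0|rewrite iterS; exact: (adm _ i.+1 IH)].
have [i [j [j0 hij]]] : exists i j, 0 < j /\ iter j (lstep phi) (iter i (lstep phi) p0) = iter i (lstep phi) p0.
  have : exists i1 i2 : 'I_#|{: A * A}|.+1, i1 != i2 /\ iter i1 (lstep phi) p0 = iter i2 (lstep phi) p0.
    suff /injectivePn[i1 [i2 ? ?]] : ~~ injectiveb (fun i : 'I_#|{: A * A}|.+1 => iter i (lstep phi) p0) by exists i1, i2.
    by apply/negP => /injectiveP /leq_card; rewrite card_ord ltnn.
  move=> [i1 [i2 []]]; wlog : i1 i2 / i1 < i2.
    move=> W ne12 e; have : (i1 : nat) != i2 by [].
    by rewrite neq_ltn => /orP[h|h]; [exact: (W i1 i2)|apply: (W i2 i1); rewrite // eq_sym].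
  move=> lt _ /esym e; exists i1, (i2 - i1); split; first by lia.
  by rewrite -iterD subnK ?(ltnW lt).
move: hij (admi i); set p := iter i _ p0 => hij ap.
exists j, (bilim (subst_pow phi j) p.1 p.2); split=> //.
have K2 : 2 <= k ^ j by rewrite (leq_trans k2)// -{1}(expn1 k) leq_pexp2l//; lia.
have hK := constant_length_pow j hk.
have e := lp j p; rewrite hij in e.
have hb : last p.1 (subst_pow phi j p.1) = p.1 by rewrite -[RHS](congr1 fst e).
have hc : head p.2 (subst_pow phi j p.2) = p.2 by rewrite -[RHS](congr1 snd e).
split; last exact: (bilim_fix K2 hK hb hc).
move=> z n; have [N0 hN0] := bilim_factor K2 hK hb hc z n.
have [n0 hn0] := primitive_ge hp.
pose s := (i.+1 + n0) * j - i.+1.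
have hs : n0 <= s by rewrite /s; nia.
exists a, (N0 + (i.+1 + n0)); apply: infix_trans (hN0 N0 (leqnn _)) _.
rewrite [X in infix _ X](iter_subst_pow phi j _ [:: a]).
have -> : (N0 + (i.+1 + n0)) * j = N0 * j + (i.+1 + s).
  by rewrite mulnDl; congr addn; rewrite /s; nia.
rewrite iterD iter_subst_pow; apply: infix_subst; apply: infix_trans ap _.
by rewrite iterD; apply: infix_subst; rewrite infix1s hn0.
Qed.

Lemma discrepancy_rate_exists (R : realType) k phi :
  2 <= k -> constant_length k phi -> primitive phi -> (exists a : A, True) ->
  exists lam : R, is_discrepancy_rate k phi lam.
Proof.
move=> k2 hk hp hA.
suff [j [x [j0 j1 fx]]] : exists j x, [/\ 0 < j,
   (exists y, fixed_point k phi y) -> j = 1 & fixed_point (k ^ j) (subst_pow phi j) x].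
  have K2 : 2 <= k ^ j by rewrite (leq_trans k2)// -{1}(expn1 k) leq_pexp2l//; lia.
  have [h hh] := fixed_height K2 (constant_length_pow j hk) (primitive_pow j0 hp) fx.
  by eexists; exists j, x, h.
have [[y fy]|nofix] := pselect (exists y, fixed_point k phi y).
  exists 1, y; split => //; rewrite expn1.
  by have -> : subst_pow phi 1 = phi
    by apply/funext => b; rewrite /subst_pow /= /subst_word /= cats0.
by have [j [x [j0 fx]]] := periodic_point k2 hk hp hA; exists j, x; split.
Qed.
End Existence.

(* Main.v *)
Require Import Defs.
From mathcomp Require Import all_boot all_order all_algebra.
From mathcomp Require Import finmap complex zify ring lra.
From mathcomp Require Import all_classical all_reals all_analysis.

(* Let [x] be a fixed point of [psi = phi^j], of length [K = k^j], let [c] be the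
   sequence of its blocks of length [h] (the height), let [rho] be the discrepancy
   rate of [psi], and let [D n i l] be the number of mismatches between the level-[n]
   images of the blocks [c i] and [c l].
   - The numbers [D n] are column sums of powers of the incidence matrix of the
     discrepancy substitution. So they are [O(r^n)] for every [r > rho] (by
     Cayley-Hamilton) and at least [rho^n] for some pair (by a left eigenvector).
   - Upper bound: every point of the subshift is a limit of shifts of [x] by amounts
     in a fixed class modulo [h K^n]; two points with the same class disagree with
     density [O((r/K)^n)], so there are at most [h K^n] separated points.
   - Lower bound: the [K^n] points [T^(hm) x], [m < K^n], are separated by a constant
     times [(rho/K)^n]. Call [i] and [l] equivalent if [D n i l = o(rho^n)]; otherwise
     [D n i l >= kappa rho^n] for all [n]. Writing [m' - m = K^i q] with [K] not
     dividing [q], it suffices that the sequence [y] of equivalence classes disagrees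
     with its shift by [q] with a density bounded below uniformly in [q]. If not,
     [y] would be periodic on arbitrarily long windows, hence periodic by recurrence;
     its least period would then be coprime to [K] and divide all return times, so
     it would be 1 by definition of the height, and [y] would be constant. *)

Set Implicit Arguments.
Unset Strict Implicit.
Unset Printing Implicit Defensive.

Import Order.TTheory GRing.Theory Num.Theory.
Import numFieldNormedType.Exports.

Local Open Scope classical_set_scope.
Local Open Scope ring_scope.

(** * Growth of linear recursions *)

Section SpectralRadius.
Variable R : realType.
Implicit Types (n : nat) (r : R).

Notation normc := ComplexField.Normc.normc.

Lemma normC_normc (z : R[i]) : `|z| = (normc z)%:C%C.
Proof. by []. Qed.

Lemma normc_nonneg (z : R[i]) : 0 <= normc z.
Proof. by case: z => a b; rewrite /= sqrtr_ge0. Qed.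

(** The characteristic polynomial splits over [R[i]], so the eigenvalues form a finite nonempty list
    of roots and the supremum is a maximum. *)
Lemma spectral_radius_attained n (M : 'M[R]_n.+1) :
  (exists2 z, eigenvalue (map_mx (real_complex R) M) z &
     normc z = spectral_radius M) /\
  (forall z, eigenvalue (map_mx (real_complex R) M) z ->
     normc z <= spectral_radius M).
Proof.
set Mc := map_mx _ M; pose E := [set normc z | z in [set z | eigenvalue Mc z]].
have [s sE] := closed_field_poly_normal (char_poly Mc).
have evE z : eigenvalue Mc z = (z \in s).
  rewrite eigenvalue_root_char sE rootZ ?root_prod_XsubC //.
  by rewrite lead_coef_eq0 monic_neq0 ?char_poly_monic.
have s0 : s != [::].
  apply/eqP => s0; have := size_char_poly Mc.
  by rewrite sE s0 big_nil (monicP (char_poly_monic _)) scale1r size_poly1.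
have [z zs zmax] : exists2 z, z \in s & forall t, t \in s -> normc t <= normc z.
  elim: s s0 {sE evE} => // a [|b s] IH _.
    by exists a; rewrite ?inE // => t; rewrite inE => /eqP->.
  have [//|z zs zmax] := IH; have [az|za] := leP (normc a) (normc z).
    exists z => [|t]; first by rewrite inE zs orbT.
    by rewrite inE => /orP[/eqP->//|/zmax].
  exists a => [|t]; first by rewrite inE eqxx.
  by rewrite inE => /orP[/eqP->//|/zmax/le_trans]; apply; exact: ltW.
have ubE : ubound E (normc z) by move=> _ [t /= + <-]; rewrite evE => /zmax.
have Ez : E (normc z) by exists z; rewrite //= evE.
have supE : spectral_radius M = normc z.
  by apply/eqP; rewrite eq_le ge_sup ?ub_le_sup//; exists (normc z).
split; first by exists z; rewrite ?evE.
by move=> t; rewrite evE supE; exact: zmax.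
Qed.

Lemma spectral_radius_empty (M : 'M[R]_0) : spectral_radius M = 0.
Proof.
rewrite /spectral_radius -[RHS]sup0; congr sup; apply/seteqP; split=> // r [z /=].
by rewrite /eigenvalue /eigenspace => /negP; case; apply/eqP/matrixP => -[].
Qed.

Lemma spectral_radius_ge0 n (M : 'M[R]_n) : 0 <= spectral_radius M.
Proof.
case: n M => [|n] M; first by rewrite spectral_radius_empty.
by have [[z _ <-] _] := spectral_radius_attained M; exact: normc_nonneg.
Qed.

(** Let [w] be the entrywise modulus of a left eigenvector for an eigenvalue of maximal modulus [r].
    The triangle inequality gives [r w <= w M], and iterating it bounds [D] from below at an index
    where [w] is largest. *)
Lemma spectral_radius_lower n (M : 'M[R]_n) (D : nat -> 'I_n -> R) :
  (forall i j, 0 <= M i j) ->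
  (forall j, D 0%N j = 1) ->
  (forall m j, D m.+1 j = \sum_i D m i * M i j) ->
  0 < spectral_radius M ->
  exists i, forall m, spectral_radius M ^+ m <= D m i.
Proof.
move=> M0 D0 DS r0.
case: n M D M0 D0 DS r0 => [|n] M D M0 D0 DS r0.
  by move: r0; rewrite spectral_radius_empty ltxx.
have [[z /eigenvalueP[v vM v0] zr] _] := spectral_radius_attained M.
set r := spectral_radius M in zr r0 *.
pose w i := normc (v 0 i).
have w0 i : 0 <= w i by exact: normc_nonneg.
pose i0 := [arg max_(i > ord0) w i]%O.
have wmax i : w i <= w i0 by rewrite /i0; case: arg_maxP => // j _; apply.
have wpos : 0 < w i0.
  have /rV0Pn[i vi] := v0; apply: lt_le_trans (wmax i).
  rewrite lt_neqAle w0 andbT eq_sym; apply: contra vi => /eqP.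
  by move/ComplexField.Normc.eq0_normc ->.
have step j : r * w j <= \sum_i w i * M i j.
  rewrite -lecR -zr rmorphM /= rmorph_sum /= -!normC_normc -normrM.
  have -> : z * v 0 j = (v *m map_mx (real_complex R) M) 0 j by rewrite vM mxE.
  rewrite mxE; apply: le_trans (ler_norm_sum _ _ _) _; apply: ler_sum => i _.
  by rewrite normrM rmorphM !mxE /= (ger0_norm (x := (M i j)%:C%C)) // ler0c.
exists i0 => m; rewrite -(ler_pM2r wpos) [leRHS]mulrC.
(* The induction proves [r ^+ m * w j <= w i0 * D m j] for all [j], with [w i0] kept fixed. *)
elim: m {-2}i0 => [|m IH] j; first by rewrite D0 expr0 mul1r mulr1; exact: wmax.
rewrite exprSr -mulrA DS; apply: le_trans (ler_wpM2l _ (step j)) _.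
  by rewrite exprn_ge0 // ltW.
rewrite !mulr_sumr; apply: ler_sum => i _; rewrite !mulrA.
by rewrite ler_wpM2r // IH.
Qed.

(* If [(S - z) u] is [O(r^m)] for the shift [S] and [|z| < r], so is [u]. *)
Lemma geometric_bound_factor (u : nat -> R[i]) (z : R[i]) r (C : R) :
  0 <= C -> normc z < r ->
  (forall m, `|u m.+1 - z * u m| <= (C * r ^+ m)%:C%C) ->
  exists2 C', 0 <= C' & forall m, `|u m| <= (C' * r ^+ m)%:C%C.
Proof.
move=> C0 zr hu; have r0 : 0 <= r by rewrite (le_trans _ (ltW zr))// normc_nonneg.
pose C' := normc (u 0%N) + C / (r - normc z).
have rz : 0 < r - normc z by rewrite subr_gt0.
have C'0 : 0 <= C'.
  by rewrite addr_ge0 ?normc_nonneg // divr_ge0 // ltW.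
exists C' => //; elim=> [|m IH].
  by rewrite expr0 mulr1 normC_normc lecR lerDl divr_ge0 // ltW.
rewrite -(subrK (z * u m) (u m.+1)) (le_trans (ler_normD _ _)) //.
apply: le_trans (lerD (hu m) (lexx _)) _; rewrite normrM.
apply: le_trans (lerD (lexx _) (ler_wpM2l (normr_ge0 z) IH)) _.
rewrite normC_normc -rmorphM -rmorphD lecR /= exprS.
have -> : C * r ^+ m + normc z * (C' * r ^+ m) = (C + normc z * C') * r ^+ m by ring.
rewrite mulrA ler_wpM2r ?exprn_ge0 //.
suff : C <= C' * (r - normc z) by lra.
by rewrite mulrDl divfK ?gt_eqF // lerDr mulr_ge0 ?normc_nonneg // ltW.
Qed.

(** By Cayley-Hamilton the product of the operators (shift minus eigenvalue) kills the sequence. The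
    factors are removed one at a time, each keeping the bound [O(r^m)] because its eigenvalue has
    modulus less than [r]. *)
Lemma spectral_radius_upper n (M : 'M[R]_n) (D : nat -> 'I_n -> R) r :
  (forall m j, D m.+1 j = \sum_i D m i * M i j) ->
  spectral_radius M < r ->
  exists2 C, 0 <= C & forall m j, `|D m j| <= C * r ^+ m.
Proof.
case: n M D => [|n] M D DS rM; first by exists 0 => // m [].
set Mc := map_mx (real_complex R) M.
have [_ ev_le] := spectral_radius_attained M.
have [s sE] := closed_field_poly_normal (char_poly Mc).
have sr z : z \in s -> normc z < r.
  move=> zs; apply: le_lt_trans rM; apply: ev_le.
  rewrite eigenvalue_root_char sE rootZ ?root_prod_XsubC //.
  by rewrite lead_coef_eq0 monic_neq0 ?char_poly_monic.
pose u m : 'rV[R[i]]_n.+1 := \row_j (D m j)%:C%C.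
have uS m : u m.+1 = u m *m Mc.
  apply/rowP => j; rewrite !mxE DS rmorph_sum /=; apply: eq_bigr => i _.
  by rewrite !mxE rmorphM.
have r0 : 0 < r by apply: le_lt_trans rM; exact: spectral_radius_ge0.
have finish (v : nat -> 'rV[R[i]]_n.+1) :
    (forall j, exists2 C, 0 <= C & forall m, `|v m 0 j| <= (C * r ^+ m)%:C%C) ->
    exists2 C, 0 <= C & forall m j, `|v m 0 j| <= (C * r ^+ m)%:C%C.
  move=> /fin_all_exists2[C C0 hC]; exists (\sum_j C j) => [|m j].
    by apply: sumr_ge0 => j _.
  rewrite (le_trans (hC j m))// lecR (ler_wpM2r (exprn_ge0 _ (ltW r0)))//.
  by rewrite (bigD1 j)//= lerDl; apply: sumr_ge0.
(* With [v m] the row [u m] times the remaining factors, the factor ['X - z] turns [v m] into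
   [v m.+1 - z v m]. *)
have key s' : all (fun z => normc z < r) s' ->
    (exists2 C, 0 <= C & forall m j,
      `|(u m *m horner_mx Mc (\prod_(z <- s') ('X - z%:P))) 0 j| <= (C * r ^+ m)%:C%C) ->
    exists2 C, 0 <= C & forall m j, `|u m 0 j| <= (C * r ^+ m)%:C%C.
  elim: s' => [_ [C C0 hC]|z s' IH /= /andP[zr alls] [C C0 hC]].
    by exists C => // m j; have := hC m j; rewrite big_nil rmorph1 mulmx1.
  apply: IH => //; apply: finish => j.
  apply: (geometric_bound_factor C0 zr) => m; apply: le_trans (hC m j).
  rewrite big_cons rmorphM rmorphB /= horner_mx_X horner_mx_C uS.
  by rewrite mulmxA mulmxBr mul_mx_scalar mulmxBl -scalemxAl !mxE.
have [C C0 hC] : exists2 C, 0 <= C & forall m j, `|u m 0 j| <= (C * r ^+ m)%:C%C.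
  apply: (key s); first exact/allP.
  exists 0 => // m j; have := Cayley_Hamilton Mc.
  rewrite sE (monicP (char_poly_monic _)) scale1r => ->.
  by rewrite mulmx0 mxE normr0 mul0r.
exists C => // m j; have := hC m j; rewrite mxE normC_normc lecR.
by rewrite /= expr0n /= addr0 sqrtr_sqr.
Qed.
End SpectralRadius.

(** * Mismatches under iterated substitution *)

Lemma sum_ord_mul (a b : nat) (F : nat -> nat) :
  (\sum_(t < a * b) F t = \sum_(s < a) \sum_(t < b) F (s * b + t))%N.
Proof.
elim: a => [|a IH]; first by rewrite mul0n !big_ord0.
by rewrite big_ord_recr /= -IH mulSnr big_split_ord.
Qed.

Section Mismatches.
Variables (B : finType) (K : nat) (c : int -> B).
Hypothesis K2 : (2 <= K)%N.

(* The letter at position [i] of a fixed point of a substitution of length [K] gives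
   rise, after [n] steps, to the letters at positions [child n i t], [t < K ^ n]. *)
Definition child (n : nat) (i : int) (t : nat) : int := i * (K ^ n)%N%:Z + t%:Z.

(** Being fixed by some substitution of length [K], without naming it; this covers letters, blocks
    and growth classes alike. *)
Definition substitutive (T : Type) (y : int -> T) :=
  forall i j t, (t < K)%N -> y i = y j -> y (child 1 i t) = y (child 1 j t).

Lemma child_child n m i s t :
  child m (child n i s) t = child (n + m) i (s * K ^ m + t).
Proof. by rewrite /child expnD !PoszD !PoszM mulrDl mulrA addrA. Qed.

Lemma child0 i : child 0 i 0 = i.
Proof. by rewrite /child expn0 mulr1 addr0. Qed.

Lemma substitutive_iter (T : Type) (y : int -> T) n i j t : substitutive y ->
  (t < K ^ n)%N -> y i = y j -> y (child n i t) = y (child n j t).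
Proof.
move=> ysub; elim: n t => [|n IH] t tn yij; first by move: tn; case: t => //; rewrite !child0.
have tE : (t = t %/ K * K ^ 1 + t %% K)%N by rewrite expn1 -divn_eq.
rewrite tE -addn1 -!child_child; apply: ysub; first by rewrite ltn_mod; lia.
by apply: IH => //; rewrite ltn_divLR -?expnSr//; lia.
Qed.

Definition mismatches (n : nat) (i j : int) : nat :=
  \sum_(t < K ^ n) (c (child n i t) != c (child n j t)).

Local Notation D := mismatches.

Hypothesis csub : substitutive c.

Lemma mismatches0 i j : D 0 i j = (c i != c j).
Proof. by rewrite /D big_ord1 !child0. Qed.

Lemma mismatchesD n m i j :
  D (n + m) i j = (\sum_(s < K ^ n) D m (child n i s) (child n j s))%N.
Proof.
rewrite /D expnD.
rewrite (sum_ord_mul _ _ (fun t => (c (child (n + m) i t) != c (child (n + m) j t)) : nat)).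
by apply: eq_bigr => s _; apply: eq_bigr => t _; rewrite !child_child.
Qed.

Lemma mismatchesS n i j :
  D n.+1 i j = (\sum_(t < K) D n (child 1 i t) (child 1 j t))%N.
Proof. by rewrite -add1n mismatchesD expn1. Qed.

Lemma mismatches_eq0 n i j : c i = c j -> D n i j = 0%N.
Proof.
by move=> cij; apply: big1 => t _; rewrite (substitutive_iter csub (ltn_ord t) cij) eqxx.
Qed.

Lemma mismatches_eq n i j i' j' : c i = c i' -> c j = c j' -> D n i j = D n i' j'.
Proof.
move=> ci cj; apply: eq_bigr => t _.
by rewrite (substitutive_iter csub (ltn_ord t) ci) (substitutive_iter csub (ltn_ord t) cj).
Qed.

Lemma mismatchesC n i j : D n i j = D n j i.
Proof. by apply: eq_bigr => t _; rewrite eq_sym. Qed.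

Lemma mismatches_triangle n i j l : (D n i l <= D n i j + D n j l)%N.
Proof.
rewrite -big_split /=; apply: leq_sum => t _.
by case: eqVneq => // n1; case: eqVneq => // n2; case: eqVneq => // n3; case/eqP: n1; rewrite n2.
Qed.

Lemma mismatches_leq n i j : (D n i j <= K ^ n)%N.
Proof.
by rewrite -[leqRHS]card_ord -sum1_card; apply: leq_sum => t _; case: (_ != _).
Qed.

Lemma mismatches_child n m i j s : (s < K ^ n)%N ->
  (D m (child n i s) (child n j s) <= D (n + m) i j)%N.
Proof. by move=> sn; rewrite mismatchesD (bigD1 (Ordinal sn)) //= leq_addr. Qed.

Lemma mismatches_growth n m i j : (D (n + m) i j <= D n i j * K ^ m)%N.
Proof.
rewrite mismatchesD {2}/D big_distrl /=; apply: leq_sum => s _.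
case: eqVneq => [/mismatches_eq0->//|_]; rewrite mul1n; exact: mismatches_leq.
Qed.

(** Every [n] further levels, a mismatching pair leaves at most [U] mismatches, and an agreeing pair
    none. The [b] initial levels are bounded trivially. *)
Lemma mismatches_contract n U i j :
  (forall s t, (t < K ^ s)%N -> (D n (child s i t) (child s j t) <= U)%N) ->
  forall a b, (D (b + a * n) i j <= U ^ a * K ^ b)%N.
Proof.
move=> hU; elim=> [|a IH] b; first by rewrite addn0 mul1n mismatches_leq.
rewrite mulSnr addnA mismatchesD expnS -mulnA.
apply: leq_trans (leq_mul (leqnn U) (IH b)); rewrite {2}/D big_distrr /=.
apply: leq_sum => s _; case: eqVneq => [/mismatches_eq0->//|_].
by rewrite muln1 hU.
Qed.

(* Enough levels to reach, from a pair of letters, every pair of letters below it. *)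
Definition pair_depth : nat :=
  \max_(q : (B * B) * (B * B))
    xget 0%N [set s | exists i j t, [/\ (t < K ^ s)%N, (c i, c j) = q.1 &
                                    (c (child s i t), c (child s j t)) = q.2]].

Lemma pair_depthP s t i j : (t < K ^ s)%N ->
  exists s' t', [/\ (s' <= pair_depth)%N, (t' < K ^ s')%N,
    c (child s' i t') = c (child s i t) & c (child s' j t') = c (child s j t)].
Proof.
move=> ts.
pose q := ((c i, c j), (c (child s i t), c (child s j t))).
pose f (q : (B * B) * (B * B)) :=
  xget 0%N [set s | exists i j t, [/\ (t < K ^ s)%N, (c i, c j) = q.1 &
                                    (c (child s i t), c (child s j t)) = q.2]].
have fle : (f q <= pair_depth)%N by rewrite /pair_depth (bigD1 q) //= leq_maxl.
have : exists i' j' t', [/\ (t' < K ^ f q)%N, (c i', c j') = q.1 &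
                         (c (child (f q) i' t'), c (child (f q) j' t')) = q.2].
  rewrite /f; case: xgetP => [_ -> //|/(_ s) []]; by exists i, j, t.
case=> i' [j' [t' [t'f [ci cj] [di dj]]]]; exists (f q), t'; split=> //.
  by rewrite -(substitutive_iter csub t'f ci).
by rewrite -(substitutive_iter csub t'f cj).
Qed.

(** * Pairs with negligible growth and the resulting equivalence classes *)

Section Growth.
Variables (R : realType) (rho : R).
Hypotheses (rho0 : 0 < rho) (rhoK : rho <= K%:R).

Definition negligible i j :=
  forall e : R, 0 < e -> exists N, forall m, (N <= m)%N -> (D m i j)%:R <= e * rho ^+ m.

(** If for every [n] some pair below [(i, j)] has at least [rho^n] mismatches, that pair already
    occurs within [pair_depth] levels, which costs a constant factor. Otherwise, for one [n], all
    pairs below stay strictly under [rho^n], and this gain compounds every [n] levels. *)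
Lemma mismatches_dichotomy i j :
  negligible i j \/ forall n, K%:R ^- pair_depth * rho ^+ n <= (D n i j)%:R.
Proof.
have K0 : 0 < K%:R :> R by rewrite ltr0n; lia.
have [h|] := pselect (forall n, exists s t,
    (t < K ^ s)%N /\ rho ^+ n <= (D n (child s i t) (child s j t))%:R).
  right=> n; have [s [t [ts hD]]] := h n.
  have [s' [t' [s'd t's ci cj]]] := pair_depthP i j ts.
  rewrite mulrC ler_pdivrMr ?exprn_gt0 // (le_trans hD) //.
  rewrite -(mismatches_eq n ci cj) -natrX -natrM ler_nat.
  apply: leq_trans (mismatches_child n i j t's) _; rewrite addnC.
  apply: leq_trans (mismatches_growth _ _ _ _) _.
  by rewrite leq_mul2l leq_exp2l ?s'd ?orbT.
move=> /existsNP[n hn]; left.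
have hn' s t : (t < K ^ s)%N -> (D n (child s i t) (child s j t))%:R < rho ^+ n.
  by move=> ts; rewrite ltNge; apply/negP => hle; apply: hn; exists s, t.
(* Mismatch counts are integers at most [K ^ n], so the strict bounds have a common integer bound
   [U], still less than [rho ^+ n]. *)
pose U := (\max_(v < (K ^ n).+1 | ((v : nat)%:R < rho ^+ n)%R) v)%N.
have hU s t : (t < K ^ s)%N -> (D n (child s i t) (child s j t) <= U)%N.
  move=> ts; have lt : (D n (child s i t) (child s j t) < (K ^ n).+1)%N by rewrite ltnS mismatches_leq.
  by rewrite -[leqLHS]/(nat_of_ord (Ordinal lt)) /U (bigD1 (Ordinal lt)) /= ?leq_maxl ?hn'.
have Un : U%:R < rho ^+ n.
  by rewrite /U; elim/big_ind: _ => [|a b|v //]; rewrite ?exprn_gt0 // => ha hb; case: leqP.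
pose th := U%:R / rho ^+ n.
have th0 : 0 <= th by rewrite divr_ge0 // exprn_ge0 // ltW.
have th1 : th < 1 by rewrite ltr_pdivrMr ?exprn_gt0 // mul1r.
(* [Q] bounds the cost of the [m %% n] levels that do not fill a group of [n]. *)
pose Q := (K%:R / rho) ^+ n.
have Q0 : 0 < Q by rewrite exprn_gt0 // divr_gt0.
have KQ : 1 <= K%:R / rho by rewrite ler_pdivlMr // mul1r.
move=> e e0.
have [a0 ha0] : exists a0, forall a, (a0 <= a)%N -> th ^+ a * Q <= e.
  have : (fun a => th ^+ a) @ \oo --> (0 : R) by apply: cvg_expr; rewrite ger0_norm.
  move=> /cvgrPdist_le /(_ (e / Q)) [|N _ hN]; first by rewrite divr_gt0.
  exists N => a Na; rewrite -ler_pdivlMr //; have := hN a Na.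
  by rewrite sub0r normrN ger0_norm // exprn_ge0.
(* For [n = 0] there are no groups of levels to count; but then [U < 1], so there are no mismatches
   at all. *)
have [n0|n0] := posnP n.
  exists 0%N => m _; suff -> : D m i j = 0%N by rewrite mulr_ge0 ?exprn_ge0 // ltW.
  have U0 : U = 0%N by move: Un; rewrite n0 expr0 -[1]/(1%:R) ltr_nat ltnS leqn0 => /eqP.
  by have := mismatches_contract hU 1 m; rewrite n0 U0 muln0 addn0 expn1 mul0n leqn0 => /eqP.
exists (a0 * n)%N => m hm.
have hb := mismatches_contract hU (m %/ n) (m %% n).
have mE : (m %% n + m %/ n * n)%N = m by rewrite addnC -divn_eq.
rewrite mE in hb.
have bn : (m %% n <= n)%N by rewrite ltnW // ltn_mod.
apply: le_trans (_ : (U ^ (m %/ n) * K ^ (m %% n))%N%:R <= _); first by rewrite ler_nat.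
rewrite natrM !natrX -[in rho ^+ m]mE exprD.
have -> : U%:R ^+ (m %/ n) = th ^+ (m %/ n) * rho ^+ (m %/ n * n) :> R.
  by rewrite mulnC exprM -exprMn divfK // expf_neq0 // gt_eqF.
have -> : K%:R ^+ (m %% n) = (K%:R / rho) ^+ (m %% n) * rho ^+ (m %% n) :> R.
  by rewrite -exprMn divfK // gt_eqF.
rewrite mulrACA [rho ^+ _ * rho ^+ _]mulrC ler_pM2r ?mulr_gt0 ?exprn_gt0 //.
have ha := ha0 (m %/ n)%N; rewrite leq_divRL // in ha; apply: le_trans (ha hm).
by rewrite ler_wpM2l ?exprn_ge0 // ler_weXn2l.
Qed.

Lemma negligible_refl i : negligible i i.
Proof.
by move=> e e0; exists 0%N => m _; rewrite mismatches_eq0 // mulr_ge0 ?exprn_ge0 // ltW.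
Qed.

Lemma negligible_sym i j : negligible i j -> negligible j i.
Proof. by move=> h e /h[N hN]; exists N => m; rewrite mismatchesC; exact: hN. Qed.

Lemma negligible_trans i j l : negligible i j -> negligible j l -> negligible i l.
Proof.
move=> hij hjl e e0; have e2 : 0 < e / 2 by rewrite divr_gt0.
have [N hN] := hij _ e2; have [N' hN'] := hjl _ e2; exists (maxn N N') => m.
rewrite geq_max => /andP[/hN h1 /hN' h2].
apply: le_trans (_ : (D m i j + D m j l)%N%:R <= _).
  by rewrite ler_nat mismatches_triangle.
by rewrite natrD (le_trans (lerD h1 h2)) // -mulrDl -splitr.
Qed.

Lemma negligible_child i j t : (t < K)%N -> negligible i j ->
  negligible (child 1 i t) (child 1 j t).
Proof.
move=> tK h e e0; have [|N hN] := h (e / rho); first by rewrite divr_gt0.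
exists N => m Nm; apply: le_trans (_ : (D m.+1 i j)%:R <= _).
  by rewrite ler_nat -add1n mismatches_child // expn1.
by rewrite (le_trans (hN _ (leqW Nm))) // exprS mulrA divfK // gt_eqF.
Qed.

Lemma negligible_parent i j :
  (forall t, (t < K)%N -> negligible (child 1 i t) (child 1 j t)) -> negligible i j.
Proof.
move=> h e e0.
have K0 : 0 < K%:R :> R by rewrite ltr0n; lia.
(* Division by [K] pays for summing over the [K] children, the factor [rho] for the change of
   level. *)
have e'0 : 0 < e * rho / K%:R by rewrite divr_gt0 // mulr_gt0.
have h' (t : 'I_K) : exists N, forall m, (N <= m)%N ->
    (D m (child 1 i t) (child 1 j t))%:R <= e * rho / K%:R * rho ^+ m by exact: h.
have [N hN] := fin_all_exists h'.
exists (\max_t N t).+1 => -[//|m]; rewrite ltnS => hm; rewrite mismatchesS natr_sum.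
have -> : e * rho ^+ m.+1 = \sum_(t < K) (e * rho / K%:R * rho ^+ m).
  rewrite sumr_const card_ord -mulr_natr exprS; field; exact: lt0r_neq0.
by apply: ler_sum => t _; apply: hN; apply: (leq_trans _ hm); rewrite (bigD1 t) //= leq_maxl.
Qed.

(** The equivalence class of [i] is recorded by the letters found in it, so that classes live in a
    finite type. *)
Definition growth_class (i : int) : {set B} :=
  [set b | `[< exists2 j, c j = b & negligible i j >]]%SET.

Lemma growth_classP i j : growth_class i = growth_class j <-> negligible i j.
Proof.
split=> [/setP/(_ (c j))|hij].
  rewrite !inE => e; have : `[< exists2 l, c l = c j & negligible j l >].
    by apply/asboolP; exists j => //; exact: negligible_refl.
  rewrite -e => /asboolP[l cl il]; apply: negligible_trans il _.
  move=> f f0; exists 0%N => m _.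
  by rewrite mismatches_eq0 // mulr_ge0 ?exprn_ge0 // ltW.
apply/setP => b; rewrite !inE; apply: asbool_equiv_eq; split=> -[l cl nl]; exists l => //.
  by apply: negligible_trans nl; exact: negligible_sym.
exact: negligible_trans nl.
Qed.

Lemma growth_class_eq i j : c i = c j -> growth_class i = growth_class j.
Proof.
move=> cij; apply/growth_classP => e e0; exists 0%N => m _.
by rewrite mismatches_eq0 // mulr_ge0 ?exprn_ge0 // ltW.
Qed.

Lemma growth_class_substitutive : substitutive growth_class.
Proof. by move=> i j t tK /growth_classP h; apply/growth_classP; exact: negligible_child. Qed.

Lemma growth_class_parent i j :
  (forall t, (t < K)%N -> growth_class (child 1 i t) = growth_class (child 1 j t)) ->
  growth_class i = growth_class j.
Proof.
by move=> h; apply/growth_classP; apply: negligible_parent => t /h /growth_classP.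
Qed.

Lemma growth_class_lower i j n : growth_class i <> growth_class j ->
  K%:R ^- pair_depth * rho ^+ n <= (D n i j)%:R.
Proof. by move=> nij; case: (mismatches_dichotomy i j) => [/growth_classP|]. Qed.

Lemma growth_class_neq i j : (forall n, rho ^+ n <= (D n i j)%:R) ->
  growth_class i <> growth_class j.
Proof.
move=> h /growth_classP/(_ 2^-1) []; first by rewrite invr_gt0.
move=> N /(_ N (leqnn N)) hN; have := le_trans (h N) hN.
by rewrite -subr_ge0 -{2}[rho ^+ N]mul1r -mulrBl pmulr_lge0 ?exprn_gt0 //; lra.
Qed.
End Growth.
End Mismatches.

(** * Aperiodicity and shifts *)

(** The quotient [K^n / gcd(q, K^n)] at least doubles with each [n]: otherwise
    [gcd(q, K^(n+1)) = K gcd(q, K^n)], and [K] would divide [q]. *)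
Lemma leq_gcd_expn (K q n : nat) : (2 <= K)%N -> ~~ (K %| q)%N ->
  (n.+1 * gcdn q (K ^ n) <= K ^ n)%N.
Proof.
move=> K2 Kq; elim: n => [|n IH]; first by rewrite gcdn1.
set e := gcdn q (K ^ n) in IH *; set e' := gcdn q (K ^ n.+1).
have [Q QE] : exists Q, (K ^ n = Q * e)%N by apply/dvdnP; exact: dvdn_gcdr.
have [a aE] : exists a, (K * e = a * e')%N.
  by apply/dvdnP; rewrite /e muln_gcdr -expnS dvdn_gcd dvdn_gcdr dvdn_mull // dvdn_gcdl.
have Kn0 : (0 < K ^ n)%N by rewrite expn_gt0; lia.
have e0 : (0 < e)%N by move: Kn0; rewrite QE muln_gt0 => /andP[].
have a2 : (2 <= a)%N.
  case: a aE => [|[|a]] aE //; first by lia.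
  case/negP: Kq; apply: dvdn_trans (dvdn_gcdl q (K ^ n.+1)).
  by rewrite -/e' -[e']mul1n -aE dvdn_mulr.
have Qn : (n.+1 <= Q)%N by move: IH; rewrite QE leq_pmul2r.
have -> : (K ^ n.+1 = Q * a * e')%N by rewrite expnS QE mulnCA aE mulnA.
by rewrite leq_mul2r; apply/orP; right; nia.
Qed.

Section Aperiodicity.
Variables (T : finType) (K : nat) (y : int -> T).
Hypotheses (K2 : (2 <= K)%N) (ysub : substitutive K y).

Definition period (p : nat) := forall l, y (l + p%:Z) = y l.

Lemma periodZ p l (a : int) : period p -> y (l + a * p%:Z) = y l.
Proof.
move=> hp; have H (b : nat) l' : y (l' + b%:Z * p%:Z) = y l'.
  elim: b l' => [|b IH] l'; first by rewrite mul0r addr0.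
  by rewrite -[RHS](IH l') -[RHS]hp; congr y; lia.
by case: a => b; [exact: H | rewrite -[LHS](H b.+1); congr y; lia].
Qed.

(** The least period [p] is coprime to [K], since dividing out [gcd(p, K)] leaves a period. If
    [y 0 = y m], the level-[p] images at [0] and [m] agree, so [m K^p] is a period and [p] divides
    [m]. The second hypothesis then gives [p = 1], and [y] is constant. *)
Lemma not_periodic :
  (forall i j, (forall t, (t < K)%N -> y (child K 1 i t) = y (child K 1 j t)) -> y i = y j) ->
  (forall p, coprime p K -> (forall m, (0 < m)%N -> y 0 = y m%:Z -> (p %| m)%N) -> p = 1%N) ->
  (exists i j, y i <> y j) ->
  forall p, (0 < p)%N -> ~ period p.
Proof.
move=> hpar hheight [i [j yij]] p p0 hp.
have exP : exists p, (0 < p)%N && `[< period p >].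
  by exists p; rewrite p0; apply/asboolP.
case: (ex_minnP exP) => {p p0 hp exP} p /andP[p0 /asboolP hp] pmin.
have pdvd m : period m -> (p %| m)%N.
  move=> hm; rewrite /dvdn; apply/negPn/negP => r0.
  have : (p <= m %% p)%N.
    apply: pmin; rewrite lt0n r0; apply/asboolP => l.
    rewrite -(periodZ _ (m %/ p)%N%:Z hp) -[RHS]hm; congr y.
    by rewrite {3}(divn_eq m p); lia.
  by rewrite leqNgt ltn_mod p0.
(* The children of [l + m] are those of [l] shifted by [K * m]. *)
have psat m : period (K * m) -> period m.
  move=> hm l; apply: hpar => t _; rewrite -[RHS]hm; congr y.
  by rewrite /child expn1; lia.
have cop : coprime p K.
  have [a aE] : exists a, p = (a * gcdn p K)%N by apply/dvdnP; exact: dvdn_gcdl.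
  have [b bE] : exists b, K = (b * gcdn p K)%N by apply/dvdnP; exact: dvdn_gcdr.
  have /pdvd pa : period a.
    apply: psat => l; rewrite -[RHS](periodZ _ b%:Z hp); congr y.
    by rewrite {1}bE [in RHS]aE; lia.
  have a0 : (0 < a)%N by move: p0; rewrite {1}aE muln_gt0 => /andP[].
  have := dvdn_leq a0 pa; rewrite {1}aE -{2}[a]muln1 leq_pmul2l // /coprime eqn_leq => ->.
  by rewrite gcdn_gt0 p0.
have p1 : p = 1%N.
  apply: hheight => // m m0 y0m.
  have : (p %| m * K ^ p)%N.
    apply: pdvd => l; set r := (l %% p%:Z)%Z.
    have r0 : 0 <= r by rewrite modz_ge0; lia.
    have rp : r < p%:Z by rewrite ltz_pmod.
    have lE : l = r + (l %/ p%:Z)%Z * p%:Z by rewrite /r; lia.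
    (* As [p < K ^ p], one level-[p] image contains every residue modulo [p]. *)
    have tp : (`|r| < K ^ p)%N.
      by apply: leq_trans (ltnW (ltn_expl p K2)); lia.
    have := substitutive_iter K2 ysub tp y0m.
    rewrite lE -addrA [_ * _ + _]addrC addrA !(periodZ _ _ hp) => h.
    have r0E : r = child K p 0 `|r|%N by rewrite /child mul0r add0r; lia.
    rewrite [in RHS]r0E h; congr y; rewrite /child; lia.
  by rewrite Gauss_dvdl // coprimeXr.
apply: yij; have := periodZ j (i - j) hp.
by rewrite p1 mulr1 addrC subrK.
Qed.

Hypothesis yrec : forall i j, exists W : nat, forall L : int, exists d : int,
  [/\ L <= d, d < L + W%:Z, y (i + d) = y i & y (j + d) = y j].
Hypothesis yper : forall p, (0 < p)%N -> ~ period p.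

(* If [y] agrees with all its shifts by [j q] on a long window, the window can be
   cut into level-[n] blocks at every offset in a class modulo [gcd(q, K^n)].
   As this class has more offsets than there are maps [T -> T], two of them give
   the same map, which makes the window periodic. *)
Lemma shift_mismatch : exists W J : nat, forall q : int, ~~ (K%:Z %| q)%Z ->
  forall L : int, exists l : int, exists i : nat,
  [/\ L <= l, l < L + W%:Z, (i < J)%N & y (l + i%:Z * q) <> y (l + i.+1%:Z * q)].
Proof.
(* The factorial is a multiple of every period up to [K ^ n] that may arise, so one violation of
   period [P], repeated by recurrence, serves for all [q]. *)
pose n := #|{ffun T -> T}|; pose P := ((K ^ n)`!)%N.
have P0 : (0 < P)%N by exact: fact_gt0.
have Kn0 : (0 < K ^ n)%N by rewrite expn_gt0; lia.
have /existsNP[l0 hl0] := yper P0.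
have [W0 hW0] := yrec l0 (l0 + P%:Z).
exists (W0 + P).+1, (K ^ n)%N => q Kq L.
have [//|hno] := pselect (exists l : int, exists i : nat,
  [/\ L <= l, l < L + (W0 + P).+1%:Z, (i < K ^ n)%N & y (l + i%:Z * q) <> y (l + i.+1%:Z * q)]).
exfalso; pose win l := L <= l < L + (W0 + P).+1%:Z.
have agree l j : win l -> (j <= K ^ n)%N -> y (l + j%:Z * q) = y l.
  move=> /andP[l1 l2]; elim: j => [|j IH] jK; first by rewrite mul0r addr0.
  rewrite -IH; last exact: ltnW.
  by apply: contrapT => h; apply: hno; exists l, j; split=> // e; apply: h.
have [d [Ld dW e1 e2]] := hW0 (L - l0).
suff : y (l0 + d) = y (l0 + d + P%:Z).
  by rewrite e1 addrAC e2 => h; apply: hl0; rewrite -h.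
set l := l0 + d.
have wl : win l by rewrite /win /l; lia.
have wlP : win (l + P%:Z) by rewrite /win /l; lia.
pose e := gcdn `|q| (K ^ n).
have e0 : (0 < e)%N by rewrite gcdn_gt0 Kn0 orbT.
have ne : (n.+1 * e <= K ^ n)%N by apply: leq_gcd_expn.
pose r := `|(l %% e%:Z)%Z|%N.
have re : (r < e)%N by rewrite /r; lia.
pose lift b := xget 0 [set i | y i = b].
have liftE i : y (lift (y i)) = y i by rewrite /lift; case: xgetP => [? _ //|/(_ i) []].
(* [th s] sends the letter of a level-[n] block to the letter at offset [r + s * e] in it. *)
pose th (s : 'I_n.+1) := [ffun b => y (child K n (lift b) (r + s * e))].
have tK (s : 'I_n.+1) : (r + s * e < K ^ n)%N.
  by apply: leq_trans ne; have := ltn_ord s; nia.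
have thE (s : 'I_n.+1) i : y (child K n i (r + s * e)) = th s (y i).
  by rewrite ffunE; apply: substitutive_iter => //; rewrite liftE.
have [s [s' [ss' ths]]] : exists s s' : 'I_n.+1, (s < s')%N /\ th s = th s'.
  have /injectivePn[s [s' ne' ee]] : ~~ injectiveb th.
    by apply/injectiveP => /leq_card; rewrite card_ord ltnn.
  have : (s : nat) != s' by [].
  by rewrite neq_ltn => /orP[]; [exists s, s' | exists s', s].
pose m := ((s' - s) * e)%N.
have m0 : (0 < m)%N by rewrite muln_gt0 subn_gt0 ss'.
have mP : (m %| P)%N.
  apply: dvdn_fact; rewrite m0 /=; apply: leq_trans ne.
  by rewrite leq_mul2r; apply/orP; right; have := ltn_ord s'; lia.
(* By Bezout, some multiple [j q] moves [l'] to offset [r + s * e] of a level-[n] block, and then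
   [l' + m] to offset [r + s' * e] of the same block. There [th s = th s'] applies, and [agree]
   leads back. *)
have step l' (a : int) : win l' -> win (l' + m%:Z) -> l' = l + a * e%:Z -> y (l' + m%:Z) = y l'.
  move=> w1 w2 l'E.
  have [u [v uv]] := Bezoutz q (K ^ n)%N%:Z.
  have uv' : u * q + v * (K ^ n)%N%:Z = e%:Z by rewrite uv.
  pose f := s%:Z - (l %/ e%:Z)%Z - a.
  have fE : f * e%:Z = (r + s * e)%N%:Z - l'.
    have : l = (l %/ e%:Z)%Z * e%:Z + r%:Z by rewrite /r; lia.
    by rewrite l'E /f PoszD PoszM; move: (l %/ _)%Z => g; lia.
  pose j := `|((u * f) %% (K ^ n)%N%:Z)%Z|%N.
  have jK : (j <= K ^ n)%N by rewrite /j; lia.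
  have [g gE] : exists g, j%:Z = u * f + g * (K ^ n)%N%:Z.
    by exists (- ((u * f) %/ (K ^ n)%N%:Z)%Z); rewrite /j; lia.
  have [i iE] : exists i, l' + j%:Z * q = child K n i (r + s * e).
    exists (g * q - v * f); rewrite /child.
    have -> : (r + s * e)%N%:Z = f * e%:Z + l' by rewrite fE subrK.
    rewrite gE -uv'; ring.
  rewrite -(agree l' j w1 jK) -(agree _ j w2 jK) addrAC iE thE ths -thE; congr y.
  have := ltnW ss'; rewrite /child /m; nia.
have iter (a : nat) : (a * m <= P)%N -> y (l + (a * m)%N%:Z) = y l.
  elim: a => [|a IH] aP; first by rewrite addr0.
  rewrite -IH; last by lia.
  have -> : l + (a.+1 * m)%N%:Z = l + (a * m)%N%:Z + m%:Z by rewrite mulSn; lia.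
  apply: (step _ (a * (s' - s))%N%:Z).
  - by move: wl wlP; rewrite /win; lia.
  - by move: wl wlP; rewrite /win; lia.
  - by rewrite /m mulnA PoszM.
by have := iter (P %/ m)%N; rewrite divnK // => ->.
Qed.
End Aperiodicity.

(** * Densities *)

Section WindowCounts.
Implicit Types (e : int -> bool) (L : int) (n V : nat).

Definition window_count e L n : nat := \sum_(t < n) e (L + t%:Z)%R.

Lemma window_countD e L n m :
  window_count e L (n + m) = (window_count e L n + window_count e (L + n%:Z) m)%N.
Proof.
rewrite /window_count big_split_ord /=; congr addn; apply: eq_bigr => t _.
by rewrite PoszD addrA.
Qed.

Lemma window_countM e L a V :
  window_count e L (a * V) = (\sum_(s < a) window_count e (L + (s * V)%N%:Z) V)%N.
Proof.
rewrite {1}/window_count (sum_ord_mul _ _ (fun t => e (L + t%:Z) : nat)).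
by apply: eq_bigr => s _; apply: eq_bigr => t _; rewrite PoszD addrA.
Qed.

Lemma window_count_leq e L n : (window_count e L n <= n)%N.
Proof.
by rewrite -[leqRHS]card_ord -sum1_card; apply: leq_sum => t _; case: (e _).
Qed.

Lemma window_count_sub e L n L' n' : L' <= L -> L + n%:Z <= L' + n'%:Z ->
  (window_count e L n <= window_count e L' n')%N.
Proof.
move=> h1 h2.
have -> : n' = (`|L - L'| + (n + (n' - n - `|L - L'|)))%N by lia.
rewrite window_countD; have -> : L' + `|L - L'|%N%:Z = L by lia.
by rewrite window_countD; lia.
Qed.

Lemma window_count_shift e (u : int) L n :
  window_count (fun l => e (l + u)) L n = window_count e (L + u) n.
Proof. by apply: eq_bigr => t _; rewrite addrAC. Qed.

Lemma window_count_hit e L W V l : (W <= V)%N -> L <= l -> l < L + W%:Z -> e l ->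
  (1 <= window_count e L V)%N.
Proof.
move=> WV Ll lW el; have h : (`|l - L| < V)%N by lia.
by rewrite /window_count (bigD1 (Ordinal h)) //= (_ : L + _ = l) ?el //; lia.
Qed.

Variable R : realType.

Lemma counting_window e n :
  counting ([set l | e l] `&` [set l : int | (- n%:Z <= l <= n%:Z)%R]) =
  ((window_count e (- n%:Z) (2 * n + 1))%:R : R)%:E.
Proof.
set S := _ `&` _.
pose s := [seq l <- [seq - n%:Z + t%:Z | t <- iota 0 (2 * n + 1)] | e l].
have us : uniq s.
  by rewrite filter_uniq // map_inj_uniq ?iota_uniq // => a b /addrI [].
have SE : S = [set` [fset l in s]%fset].
  apply/seteqP; split=> l /=; rewrite !inE mem_filter /S /=.
    move=> [-> /andP[h1 h2]] /=; apply/mapP; exists `|(l + n%:Z)%R|%N; last by lia.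
    by rewrite mem_iota; lia.
  by move=> /andP[-> /mapP[t]]; rewrite mem_iota => h ->; split => //; lia.
rewrite /counting SE asboolT ?finite_fset // set_fsetK; congr (_%:R%:E).
rewrite card_fseq undup_id // size_filter count_map -sum1_count big_mkcond.
rewrite -[X in iota 0 X]subn0 -/(index_iota 0 (2 * n + 1)) big_mkord.
by apply: eq_bigr => t _ /=; case: (e _).
Qed.

Lemma upper_densityP (E : set int) (a : R) :
  (forall n0, exists2 n, (n0 <= n)%N &
     a%:E <= counting (E `&` [set l : int | (- n%:Z <= l <= n%:Z)%R]) / (2 * n + 1)%:R%:E)%E ->
  (a%:E <= upper_density R E)%E.
Proof.
move=> h; rewrite /upper_density /limn_esup limf_esupE.
apply: le_ereal_inf_tmp => _ [V [n0 _ n0V] <-].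
have [n nn0 hn] := h n0; apply: le_trans hn _.
by apply: ereal_sup_ubound; exists n => //; apply: n0V.
Qed.

(** The interval [[-n, n]] contains almost [(2n+1)/V] of the windows; the loss at the ends is at
    most [2b]. *)
Lemma upper_density_lower e (o : int) V (b : R) : (0 < V)%N -> 0 <= b ->
  (forall s : int, b <= (window_count e (o + s * V%:Z) V)%:R) ->
  forall a : R, a < b / V%:R -> (a%:E <= upper_density R [set l | e l])%E.
Proof.
move=> V0 b0 hb a ab.
have V0' : 0 < V%:R :> R by rewrite ltr0n.
apply: upper_densityP => n0.
pose eps := b / V%:R - a; have eps0 : 0 < eps by rewrite subr_gt0.
(* From [n1] on, the loss [2 * b] is at most [eps * (2 * n + 1)]. *)
have [n1 hn1] : exists n1 : nat, 2 * b / eps <= n1%:R.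
  by exists (Num.truncn (2 * b / eps)).+1; exact/ltW/truncnS_gt.
exists (maxn n0 n1); first exact: leq_maxl.
set n := maxn n0 n1; rewrite counting_window inver ifF; last by rewrite gt_eqF // ltr0n addn1.
rewrite -EFinM lee_fin ler_pdivlMr; last by rewrite ltr0n addn1.
pose q := ((2 * n + 1) %/ V)%N.
have qV : (2 * n + 1 < q.+1 * V)%N by rewrite /q ltn_ceil.
have qV' : (q * V <= 2 * n + 1)%N by exact: leq_trunc_div.
pose s0 := ((- n%:Z - o) %/ V%:Z)%Z + 1.
have s0E : - n%:Z <= o + s0 * V%:Z /\ o + s0 * V%:Z <= - n%:Z + V%:Z.
  have := divz_eq (- n%:Z - o) V%:Z; have := modz_ge0 (- n%:Z - o) (_ : V%:Z != 0).
  have := ltz_pmod (- n%:Z - o) (_ : 0 < V%:Z).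
  rewrite /s0 mulrDl mul1r; move: (_ %/ _)%Z (_ %% _)%Z => u v; lia.
have cnt : ((q.-1)%:R * b <= (window_count e (- n%:Z) (2 * n + 1))%:R :> R).
  case: s0E => s1 s2.
  case qE : q qV' => [|q'] qV'; first by rewrite mul0r.
  apply: le_trans (_ : (window_count e (o + s0 * V%:Z) (q' * V))%:R <= _); last first.
    by rewrite ler_nat; apply: window_count_sub => //; move: qV'; rewrite mulSn; lia.
  rewrite window_countM natr_sum -mulr_natl mulr1 -{1}[q']card_ord -sum1_card natr_sum.
  rewrite mulr_suml; apply: ler_sum => s _; rewrite mul1r.
  by have := hb (s0 + s%:Z); rewrite mulrDl addrA PoszM.
apply: le_trans cnt.
have n1n : n1%:R <= n%:R :> R by rewrite ler_nat leq_maxr.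
have N0 : 0 < (2 * n + 1)%:R :> R by rewrite ltr0n addn1.
have epsN : 2 * b <= eps * (2 * n + 1)%:R.
  rewrite [leRHS]mulrC -ler_pdivrMr //; apply: le_trans hn1 _; apply: le_trans n1n _.
  by rewrite ler_nat; lia.
have qb : (2 * n + 1)%:R * (b / V%:R) <= (q.-1%:R + 2) * b.
  rewrite mulrCA mulrC ler_wpM2r // ler_pdivrMr // -natrD -natrM ler_nat.
  by apply: leq_trans (ltnW qV) _; rewrite leq_mul2r; apply/orP; right; lia.
move: epsN qb; rewrite /eps mulrBl mulrDl [b / _ * _]mulrC; lra.
Qed.

Lemma upper_density_upper e (a C : R) :
  (forall n, (window_count e (- n%:Z) (2 * n + 1))%:R <= a * (2 * n + 1)%:R + C) ->
  (upper_density R [set l | e l] <= a%:E)%E.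
Proof.
move=> h; rewrite /upper_density /limn_esup limf_esupE.
apply/lee_addgt0Pr => f f0; pose n1 := (Num.truncn (C / f)).+1.
apply: le_trans (ereal_inf_lbound (ex_intro2 _ _ [set n | (n1 <= n)%N] _ erefl)) _.
  by exists n1.
apply: ge_ereal_sup => _ [n /= hn <-].
rewrite counting_window inver ifF; last by rewrite gt_eqF // ltr0n addn1.
rewrite -EFinM -EFinD lee_fin ler_pdivrMr; last by rewrite ltr0n addn1.
apply: le_trans (h n) _; rewrite mulrDl lerD2l mulrC -ler_pdivrMr //.
apply: le_trans (ltW (truncnS_gt _)) _; rewrite ler_nat; apply: leq_trans hn _; lia.
Qed.
End WindowCounts.

(** * Separated points *)

Lemma sum_ord_leq a b (F : 'I_a -> nat) :
  (forall u, (F u <= b)%N) -> (\sum_u F u <= a * b)%N.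
Proof.
by move=> hF; apply: leq_trans (leq_sum _ (fun u _ => hF u)) _; rewrite sum_nat_const card_ord.
Qed.

Section Separation.
Variables (R : realType) (A B : finType) (K h : nat) (x : int -> A) (c : int -> B).
Hypotheses (K2 : (2 <= K)%N) (h0 : (0 < h)%N).
Hypothesis cE : forall i j, c i = c j <->
  forall r, (r < h)%N -> x (i * h%:Z + r%:Z) = x (j * h%:Z + r%:Z).

Local Notation D := (mismatches K c).

(** Together with [block_count_upper]: different codes mean between [1] and [h] mismatches in the
    corresponding blocks of [x], equal codes mean none. *)
Lemma block_count_lower i v :
  ((c i != c (i + v)) <= window_count (fun l => x l != x (l + v * h%:Z)) (i * h%:Z) h)%N.
Proof.
case: eqVneq => //= /eqP cne.
have [r /not_implyP[rh xr]] : exists r, ~ ((r < h)%N -> x (i * h%:Z + r%:Z) = x ((i + v) * h%:Z + r%:Z)).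
  by apply/existsNP => hr; apply: cne; apply/cE.
apply: (@window_count_hit _ _ h _ (i * h%:Z + r%:Z)) => //; [lia|lia|].
by apply/eqP; rewrite addrAC -mulrDl.
Qed.

Lemma block_count_upper i v :
  (window_count (fun l => x l != x (l + v * h%:Z)) (i * h%:Z) h <= h * (c i != c (i + v)))%N.
Proof.
case: eqVneq => [/(iffLR (cE _ _)) cij|_]; last by rewrite muln1 window_count_leq.
by rewrite muln0 leqn0; apply/eqP/big1 => r _; rewrite cij // addrAC -mulrDl eqxx.
Qed.

Lemma mismatches_count n i v :
  D n i (i + v) = window_count (fun l => c l != c (l + v * (K ^ n)%N%:Z)) (i * (K ^ n)%N%:Z) (K ^ n).
Proof. by apply: eq_bigr => t _; rewrite /child mulrDl addrAC. Qed.

(** * Lower bound for the disagreement of two shifts of the fixed point *)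

Section Lower.
Variables (T : finType) (y : int -> T) (rho kappa : R) (W J : nat).
Hypotheses (rho0 : 0 < rho) (rhoK : rho <= K%:R) (kappa0 : 0 < kappa).
Hypothesis ylower : forall n i j, y i <> y j -> kappa * rho ^+ n <= (D n i j)%:R.
Hypothesis yshift : forall q : int, ~~ (K%:Z %| q)%Z ->
  forall L : int, exists l : int, exists i : nat,
  [/\ L <= l, l < L + W%:Z, (i < J)%N & y (l + i%:Z * q) <> y (l + i.+1%:Z * q)].

(** Double counting: each of [2 J |q|] disjoint windows of length [W] has a mismatch after a shift
    by some [i q], [i < J]. For fixed [i] these mismatches lie in the large window, so [J] times its
    count is at least [2 J |q|]. The resulting density [1 / (J (W+1))] does not depend on [q]. *)
Lemma shift_mismatch_count q L : ~~ (K%:Z %| q)%Z ->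
  (2 * `|q| <= window_count (fun l => y l != y (l + q)) L (2 * J * `|q| * W.+1))%N.
Proof.
move=> Kq; set e := (fun l => y l != y (l + q)); set N := (2 * J * `|q|)%N.
have J0 : (0 < J)%N by have [l [i [_ _ + _]]] := yshift Kq 0; lia.
rewrite -(leq_pmul2l J0).
(* A margin of [J |q|] on either side leaves room for the shifts [i q] of both signs. *)
pose M := L + (J * `|q|)%N%:Z.
pose S := (\sum_(s < N) \sum_(i < J)
   window_count (fun l => e (l + i%:Z * q)%R) (M + (s * W)%N%:Z)%R W)%N.
have step : (J * (2 * `|q|) <= S)%N.
  have -> : (J * (2 * `|q|) = \sum_(s < N) 1)%N by rewrite sum1_card card_ord /N; lia.
  apply: leq_sum => s _.
  have [l [i [l1 l2 iJ yl]]] := yshift Kq (M + (s * W)%N%:Z).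
  rewrite (bigD1 (Ordinal iJ)) //= -[leqLHS]addn0; apply: leq_add => //.
  apply: (@window_count_hit _ _ W _ l) => //.
  apply/eqP; rewrite -addrA; move: yl; congr (_ <> y _).
  by rewrite -addn1 PoszD mulrDl mul1r.
apply: (leq_trans step); rewrite /S exchange_big /= -[J in leqRHS]card_ord -sum1_card big_distrl /=.
apply: leq_sum => i _; rewrite -window_countM window_count_shift mul1n.
have iJ := ltn_ord i.
have a1 : (i * `|q| <= J * `|q|)%N by rewrite leq_mul2r ltnW ?orbT.
have a2 : - (J * `|q|)%N%:Z <= i%:Z * q <= (J * `|q|)%N%:Z.
  apply/andP; split; nia.
move/andP: a2 => [a2 a3].
have NE : N = (J * `|q| + J * `|q|)%N by rewrite /N; lia.
apply: window_count_sub; rewrite /M; first by lia.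
rewrite mulnS; move: a2 a3 NE; move: (i%:Z * q) (J * `|q|)%N (N * W)%N => u v w; lia.
Qed.

(** Each mismatch between [y] and its shift by [q] expands, [i] levels below, into at least
    [kappa rho^i] mismatches of [c], each giving one of [x]. This is compared with the window length
    [V K^i h]. *)
Lemma shift_density (o q : int) i (a : R) : ~~ (K%:Z %| q)%Z ->
  a < kappa / (J * W.+1 * h)%N%:R * (rho / K%:R) ^+ i ->
  (a%:E <= upper_density R [set l : int | (x (l + o) != x (l + o + q * (K ^ i * h)%N%:Z))])%E.
Proof.
move=> Kq ha.
have q0 : (0 < `|q|)%N by rewrite absz_gt0; apply: contraNneq Kq => ->; rewrite dvdz0.
have J0 : (0 < J)%N by have [l [j [_ _ + _]]] := yshift Kq 0; lia.
pose V := (2 * J * `|q| * W.+1)%N.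
have V0 : (0 < V)%N by rewrite /V !muln_gt0 J0 q0.
have Ki0 : (0 < K ^ i)%N by rewrite expn_gt0; lia.
have K0 : 0 < K%:R :> R by rewrite ltr0n; lia.
have qE : q * (K ^ i * h)%N%:Z = q * (K ^ i)%N%:Z * h%:Z by rewrite PoszM mulrA.
pose b : R := kappa * rho ^+ i * (2 * `|q|)%N%:R.
apply: (@upper_density_lower R (fun l => x (l + o) != x (l + o + q * (K ^ i * h)%N%:Z))
   (- o) (V * (K ^ i * h)) b).
- by rewrite muln_gt0 V0 muln_gt0 Ki0 h0.
- by rewrite !mulr_ge0 ?exprn_ge0 // ltW.
- move=> s; rewrite (window_count_shift (fun l => x l != x (l + q * (K ^ i * h)%N%:Z)) o).
  rewrite addrAC addNr add0r.
  have -> : s * (V * (K ^ i * h))%N%:Z = s * V%:Z * (K ^ i)%N%:Z * h%:Z.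
    by rewrite !PoszM !mulrA.
  rewrite mulnA.
  apply: le_trans (_ : (window_count (fun l => c l != c (l + q * (K ^ i)%N%:Z))
     (s * V%:Z * (K ^ i)%N%:Z) (V * K ^ i))%:R <= _); last first.
    rewrite ler_nat [leqRHS]window_countM; apply: leq_sum => t _.
    by rewrite qE PoszM -mulrDl; exact: block_count_lower.
  apply: le_trans (_ : kappa * rho ^+ i *
      (window_count (fun l => y l != y (l + q)) (s * V%:Z) V)%:R <= _).
    apply: ler_wpM2l; first by rewrite mulr_ge0 ?exprn_ge0 // ltW.
    by rewrite ler_nat; exact: shift_mismatch_count.
  rewrite window_countM !natr_sum mulr_sumr; apply: ler_sum => t _.
  rewrite PoszM -mulrDl -mismatches_count.
  case: eqVneq => /= [_|/eqP/ylower]; first by rewrite mulr0.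
  by rewrite mulr1.
- apply: lt_le_trans ha _; rewrite /b /V expr_div_n.
  have Jh : 0 < (J * W.+1 * h)%N%:R :> R by rewrite ltr0n !muln_gt0 J0 h0.
  rewrite le_eqVlt; apply/orP; left; apply/eqP; rewrite !natrM natrX.
  field.
  by rewrite expf_neq0 ?(gt_eqF K0) // nat1r !pnatr_eq0 -!lt0n J0 h0 q0.
Qed.
End Lower.

(** * Upper bound for the disagreement of points in the same residue class *)

Section Upper.
Variables (n Dm : nat).
Hypothesis hDm : forall i j, (D n i j <= Dm)%N.
Local Notation H := (K ^ n * h)%N.

Let H0 : (0 < H)%N. Proof. by rewrite muln_gt0 expn_gt0 h0 andbT; lia. Qed.

Lemma block_mismatch_upper (i v : int) :
  (window_count (fun l => x l != x (l + v * H%:Z)) (i * H%:Z) H <= h * Dm)%N.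
Proof.
have vE : v * H%:Z = v * (K ^ n)%N%:Z * h%:Z by rewrite PoszM mulrA.
rewrite vE window_countM.
apply: leq_trans (_ : h * D n i (i + v) <= _)%N; last by rewrite leq_mul2l hDm orbT.
rewrite mismatches_count big_distrr /=; apply: leq_sum => t _.
by rewrite !PoszM mulrA -mulrDl; exact: block_count_upper.
Qed.

(** A window of length [N] is covered by [N %/ H + 2] aligned blocks of length [H]. *)
Lemma window_mismatch_upper (v L : int) N :
  (window_count (fun l => x l != x (l + v * H%:Z)) L N <= (N %/ H + 2) * (h * Dm))%N.
Proof.
set e := (fun l => _ != _).
pose s := (L %/ H%:Z)%Z.
have sL : s * H%:Z <= L by rewrite /s lez_floor //; lia.
have Ls : L < s * H%:Z + H%:Z.
  by have := ltz_ceil L (_ : 0 < H%:Z); rewrite -/s mulrDl mul1r; apply; lia.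
have NH : (N < (N %/ H).+1 * H)%N by rewrite ltn_ceil.
apply: (@leq_trans (window_count e (s * H%:Z) ((N %/ H + 2) * H))).
  apply: window_count_sub => //; move: NH.
  by rewrite mulSn mulnDl; move: (N %/ H * H)%N (s * H%:Z) Ls => a b; lia.
rewrite window_countM; apply: sum_ord_leq => u.
rewrite (PoszM u) -mulrDl; exact: block_mismatch_upper.
Qed.

(* [z] is a limit of shifts of [x] by amounts congruent to [m] modulo [H]. *)
Definition in_class (m : nat) (z : int -> A) :=
  forall N : nat, exists a : int, forall l : int, (`|l| <= N)%N -> z l = x (a * H%:Z + m%:Z + l).

(** If every residue [m] failed at some radius [N m], one occurrence in [x] of the central word of
    [z] of the largest such radius would have some residue, a contradiction. *)
Lemma in_class_exists z :
  (forall i N, exists p : int, forall t, (t < N)%N -> z (i + t%:Z) = x (p + t%:Z)) ->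
  exists2 m, (m < H)%N & in_class m z.
Proof.
move=> hz; apply: contrapT => hno.
have hbad (m : 'I_H) : exists N : nat, ~ exists a : int, forall l : int, (`|l| <= N)%N ->
    z l = x (a * H%:Z + (m : nat)%:Z + l).
  by apply/existsNP => hm; apply: hno; exists m.
have [N hN] := fin_all_exists hbad.
pose M := (\max_m N m)%N.
have [p hp] := hz (- M%:Z) (2 * M + 1)%N.
pose a := ((p + M%:Z) %/ H%:Z)%Z; pose m := `|((p + M%:Z) %% H%:Z)%Z|%N.
have H0' : H%:Z != 0 by lia.
have mlt : (m < H)%N by have := ltz_pmod (p + M%:Z) (_ : 0 < H%:Z); rewrite /m; lia.
have pE : p + M%:Z = a * H%:Z + m%:Z.
  by rewrite {1}(divz_eq (p + M%:Z) H%:Z) /m gez0_abs // modz_ge0.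
apply: (hN (Ordinal mlt)); exists a => l hl /=.
have lM : (`|l| <= M)%N by apply: leq_trans hl _; rewrite /M (bigD1 (Ordinal mlt)) //= leq_maxl.
have lE : p + M%:Z + l = p + `|(l + M%:Z)%R|%N%:Z by lia.
by rewrite -pE lE -hp; [congr z; lia | lia].
Qed.

Lemma same_class_upper m z z' L N : in_class m z -> in_class m z' ->
  (window_count (fun l => z l != z' l) L N <= (N %/ H + 2) * (h * Dm))%N.
Proof.
move=> hz hz'.
have [a ha] := hz (`|L| + N)%N; have [a' ha'] := hz' (`|L| + N)%N.
apply: leq_trans (window_mismatch_upper (a' - a) (a * H%:Z + m%:Z + L) N).
apply: leq_sum => t _; have tN := ltn_ord t.
rewrite ha ?ha'; [|lia|lia].
rewrite mulrBl; apply: eq_leq; congr (nat_of_bool (x _ != x _)); lia.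
Qed.

(** One mismatch between [z] and [z'] accounts for at most [2 * L0 + 1] members of [e], so the
    mismatch counts are summed over all offsets up to [L0]. *)
Lemma same_class_density m z z' (L0 : nat) (e : int -> bool) :
  in_class m z -> in_class m z' ->
  (forall l, e l -> exists2 u : int, (`|u| <= L0)%N & z (l + u) <> z' (l + u)) ->
  (upper_density R [set l | e l] <= (((2 * L0 + 1) * Dm)%N%:R / (K ^ n)%N%:R)%:E)%E.
Proof.
move=> hz hz' he.
pose C : R := ((2 * L0 + 1) * (2 * (h * Dm)))%N%:R.
apply: (@upper_density_upper R e _ C) => N.
apply: le_trans (_ : (\sum_(u < 2 * L0 + 1)
   window_count (fun l => z l != z' l) (- N%:Z - L0%:Z + u%:Z)%R (2 * N + 1))%N%:R <= _).
  rewrite ler_nat exchange_big /=; apply: leq_sum => t _.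
  case et : (e _) => //; have [u uL zu] := he _ et.
  have uL' : (`|(u + L0%:Z)%R| < 2 * L0 + 1)%N by lia.
  rewrite (bigD1 (Ordinal uL')) //=.
  rewrite (_ : - N%:Z - L0%:Z + `|(u + L0%:Z)%R|%N%:Z + t%:Z = - N%:Z + t%:Z + u); last by lia.
  by move/eqP: zu => ->.
apply: le_trans (_ : ((2 * L0 + 1) * (((2 * N + 1) %/ H + 2) * (h * Dm)))%N%:R <= _).
  by rewrite ler_nat; apply: sum_ord_leq => u; exact: same_class_upper hz hz'.
have K0 : 0 < (K ^ n)%N%:R :> R by rewrite ltr0n expn_gt0; lia.
have h0' : 0 < h%:R :> R by rewrite ltr0n.
have HN : ((2 * N + 1) %/ H)%N%:R <= (2 * N + 1)%N%:R / ((K ^ n)%N%:R * h%:R) :> R.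
  by rewrite ler_pdivlMr ?mulr_gt0 // -!natrM ler_nat leq_trunc_div.
rewrite /C; move: (K ^ n)%N K0 (2 * L0 + 1)%N (2 * N + 1)%N (_ %/ _)%N HN => k k0 w M Q QM.
rewrite !natrM natrD.
have -> : w%:R * Dm%:R / k%:R * M%:R + w%:R * (2 * (h%:R * Dm%:R))
   = w%:R * ((M%:R / (k%:R * h%:R) + 2) * (h%:R * Dm%:R)) :> R.
  by field; rewrite !gt_eqF.
by rewrite ler_wpM2l // ler_wpM2r ?mulr_ge0 // lerD2r.
Qed.
End Upper.
End Separation.

(** * The metric and the numbers of separated points *)

Section SeparationNumbers.
Variables (R : realType) (A : finType) (beta : R).
Hypothesis beta1 : 1 < beta.
Implicit Types (u v z : int -> A) (X : set (int -> A)).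

(** At [delta = 1] separation is thus the density of plain mismatches, which is all the lower bound
    uses. *)
Lemma shift_dist_ge1 u v : 1 <= shift_dist beta u v <-> u 0 <> v 0.
Proof.
rewrite /shift_dist; case: pselect => [ex|nex] /=.
  case: ex_minnP => n /asboolP[l [ln uvl]] nmin; split=> [h|uv0].
    have n0 : n = 0%N.
      case: n h {nmin ln} => // n.
      by rewrite leNgt invf_lt1 ?exprn_gt0 ?exprn_egt1 // (lt_trans ltr01).
    by move: uvl; have -> : l = 0 by lia.
  have -> : n = 0%N.
    by apply/eqP; rewrite -leqn0; apply: nmin; apply/asboolP; exists 0.
  by rewrite expr0 invr1.
split; first by rewrite ler10.
by move=> uv0; case: nex; exists 0%N; apply/asboolP; exists 0.
Qed.

Lemma shift_dist_ge (delta : R) : 0 < delta ->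
  exists L0 : nat, forall u v, delta <= shift_dist beta u v ->
    exists2 l : int, (`|l| <= L0)%N & u l <> v l.
Proof.
move=> d0; have b0 : 0 < beta by rewrite (lt_trans ltr01).
have : (fun n => beta^-1 ^+ n) @ \oo --> (0 : R).
  by apply: cvg_expr; rewrite ger0_norm ?invf_lt1 ?invr_ge0 // ltW.
move=> /cvgrPdist_lt /(_ _ d0) [N _ hN]; exists N => u v.
rewrite /shift_dist; case: pselect => [ex|nex] /=; last by rewrite leNgt d0.
case: ex_minnP => n /asboolP[l [ln uvl]] _ h; exists l => //; rewrite ln leqNgt.
apply/negP => /ltnW /hN; rewrite sub0r normrN ger0_norm ?exprn_ge0 ?invr_ge0 ?ltW //.
by rewrite exprVn ltNge h.
Qed.

(** Makes any pairwise separated family injective, so that its image has the full cardinality. *)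
Lemma not_dnu_separated_refl (delta nu : R) z : 0 < delta -> 0 < nu ->
  ~ dnu_separated beta delta nu z z.
Proof.
move=> d0 nu0; rewrite /dnu_separated.
have -> : [set l : int | (delta <= shift_dist beta (shift_pow l z) (shift_pow l z))%R] =
    [set l | (fun=> false) l].
  apply/seteqP; split=> l //=; rewrite /shift_dist; case: pselect => [ex|_] /=.
    by have [n /asboolP[? [_]]] := ex.
  by rewrite leNgt d0.
have hb : (upper_density R [set l : int | (fun=> false) l] <= 0%:E)%E.
  apply: (upper_density_upper (C := 0)) => n.
  by rewrite /window_count big1 // mul0r addr0.
by move=> h; have := le_trans h hb; rewrite lee_fin leNgt nu0.
Qed.

Lemma Sep_lower X (delta nu : R) N (f : nat -> int -> A) : 0 < delta -> 0 < nu ->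
  (forall m, (m < N)%N -> X (f m)) ->
  (forall m m', (m < N)%N -> (m' < N)%N -> m != m' ->
    dnu_separated beta delta nu (f m) (f m')) ->
  (N%:R%:E <= Sep beta X delta nu)%E.
Proof.
move=> d0 nu0 fX fsep; apply: le_trans (ereal_sup_ubound _).
  2: { exists (f @` `I_N) => //; split=> [_ [m /= mN <-]|]; first exact: fX.
       move=> _ _ [m /= mN <-] [m' /= m'N <-] ne; apply: fsep => //.
       by apply: contra_notN ne => /eqP->. }
have finj : {in `I_N &, injective f}.
  move=> m m'; rewrite !inE /= => mN m'N e; apply/eqP; apply: contrapT => /negP ne.
  by have := fsep _ _ mN m'N ne; rewrite e; exact: not_dnu_separated_refl.
have fc := inj_card_eq finj.
have ff : finite_set (f @` `I_N) by exact: finite_image.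
by rewrite /counting asboolT // lee_fin ler_nat (card_fset_set fc).
Qed.

Lemma Sep_upper X (delta nu : R) N (P : nat -> set (int -> A)) :
  (forall z, X z -> exists2 m, (m < N)%N & P m z) ->
  (forall m z z', P m z -> P m z' -> ~ dnu_separated beta delta nu z z') ->
  (Sep beta X delta nu <= N%:R%:E)%E.
Proof.
move=> hX hP; apply: ge_ereal_sup => _ [S [SX Ssep] <-].
pose g z := xget 0%N [set m | (m < N)%N /\ P m z].
have gP z : X z -> (g z < N)%N /\ P (g z) z.
  move=> /hX[m mN Pm]; rewrite /g; case: xgetP => [? _ //|/(_ m)[]//].
have ginj : {in S &, injective g}.
  move=> z z'; rewrite !inE => Sz Sz' e; apply: contrapT => ne.
  have [_ P1] := gP _ (SX _ Sz); have [_ P2] := gP _ (SX _ Sz').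
  by rewrite -e in P2; exact: hP P1 P2 (Ssep _ _ Sz Sz' ne).
have Sc : (S #<= `I_N)%card.
  have := inj_card_eq ginj; rewrite card_eq_le => /andP[_ Sle]; apply: card_le_trans Sle _.
  by apply: subset_card_le => _ [z Sz <-] /=; case: (gP z) => //; exact: SX.
have Sf : finite_set S by apply/finite_set_leP; exists N.
by rewrite /counting asboolT // lee_fin ler_nat; exact: geq_card_fset_set.
Qed.

Lemma Sep_ge1 X (delta nu : R) z : X z -> (1 <= Sep beta X delta nu)%E.
Proof.
move=> Xz; apply: le_trans (ereal_sup_ubound _).
  2: { exists [set z] => //; split=> [_ ->//|_ _ -> ->//]. }
by rewrite /counting asboolT ?finite_set1 // fset_set1 finmap.cardfs1.
Qed.

End SeparationNumbers.

(** [K] is divided out as often as possible. Since [K] may be composite, [q] can still share a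
    factor with it. *)
Lemma power_decomposition (K n : nat) (d : int) : (2 <= K)%N -> d != 0 -> (`|d| < K ^ n)%N ->
  exists i (q : int), [/\ (i < n)%N, ~~ (K%:Z %| q)%Z & d = q * (K ^ i)%N%:Z].
Proof.
move=> K2; elim: n d => [|n IH] d d0 dn; first by lia.
have [/dvdzP[d' dE]|Kd] := boolP (K%:Z %| d)%Z; last first.
  by exists 0%N, d; split=> //; rewrite mulr1.
have d'0 : d' != 0 by apply: contra_neq d0 => d'0; rewrite dE d'0 mul0r.
have [|i [q [iltn Kq d'E]]] := IH d' d'0.
  by move: dn; rewrite dE abszM absz_nat expnSr ltn_mul2r => /andP[].
by exists i.+1, q; split=> //; rewrite dE d'E expnSr PoszM mulrA.
Qed.

(** * Bounds on separation numbers at the scales [K^n] *)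

Section SeparationOfSubshift.
Variables (R : realType) (A B : finType) (K h : nat) (x : int -> A) (c : int -> B) (beta : R).
Variable X : set (int -> A).
Hypotheses (K2 : (2 <= K)%N) (h0 : (0 < h)%N) (beta1 : 1 < beta).
Hypothesis cE : forall i j, c i = c j <->
  forall r, (r < h)%N -> x (i * h%:Z + r%:Z) = x (j * h%:Z + r%:Z).

Lemma separation_lower (T : finType) (y : int -> T) (rho kappa : R) (W J : nat) :
  0 < rho -> rho <= K%:R -> 0 < kappa ->
  (forall o : int, X (shift_pow o x)) ->
  (forall n i j, y i <> y j -> kappa * rho ^+ n <= (mismatches K c n i j)%:R) ->
  (forall q : int, ~~ (K%:Z %| q)%Z ->
    forall L : int, exists l : int, exists i : nat,
    [/\ L <= l, l < L + W%:Z, (i < J)%N & y (l + i%:Z * q) <> y (l + i.+1%:Z * q)]) ->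
  exists2 C : R, 0 < C & forall n nu, 0 < nu -> nu <= C * (rho / K%:R) ^+ n ->
    ((K ^ n)%N%:R%:E <= Sep beta X 1 nu)%E.
Proof.
move=> rho0 rhoK kappa0 Xx ylower yshift.
have J0 : (0 < J)%N.
  have K1 : ~~ (K%:Z %| 1)%Z by rewrite dvdz1 absz_nat; lia.
  by have [l [j [_ _ + _]]] := yshift _ K1 0; lia.
have K0 : 0 < K%:R :> R by rewrite ltr0n; lia.
have Jh : 0 < (J * W.+1 * h)%N%:R :> R by rewrite ltr0n !muln_gt0 J0 h0.
(* The factor [1/2] yields the strict inequality required by [shift_density]. *)
pose C := kappa / (J * W.+1 * h)%N%:R / 2.
have C0 : 0 < C by rewrite !divr_gt0.
exists C => // n nu nu0 hnu.
apply: (Sep_lower (f := fun m => shift_pow (m%:Z * h%:Z) x)) => // m m' mn m'n mm'.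
have [||i [q [iltn Kq dE]]] := @power_decomposition K n (m'%:Z - m%:Z) K2; [lia|lia|].
rewrite /dnu_separated.
have -> : [set l : int | (1 <= shift_dist beta (shift_pow l (shift_pow (m%:Z * h%:Z) x))
      (shift_pow l (shift_pow (m'%:Z * h%:Z) x)))%R] =
    [set l | (fun l => x (l + m%:Z * h%:Z) != x (l + m%:Z * h%:Z + q * (K ^ i * h)%N%:Z)) l].
  have e l : l + m'%:Z * h%:Z = l + m%:Z * h%:Z + q * (K ^ i * h)%N%:Z.
    by rewrite PoszM mulrA -dE; ring.
  apply/seteqP; split=> l /=.
    by move=> /(shift_dist_ge1 beta1); rewrite /shift_pow !add0r e => /eqP.
  by move=> /eqP ne; apply/(shift_dist_ge1 beta1); rewrite /shift_pow !add0r e.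
apply: (shift_density K2 h0 cE rho0 rhoK kappa0 ylower yshift) => //.
have rK : 0 < rho / K%:R by rewrite divr_gt0.
apply: le_lt_trans hnu _; apply: (@le_lt_trans _ _ (C * (rho / K%:R) ^+ i)).
  rewrite ler_wpM2l ?(ltW C0) // ler_wiXn2l ?(ltW rK) ?(ltnW iltn) //.
  by rewrite ler_pdivrMr // mul1r.
by rewrite ltr_pM2r ?exprn_gt0 // /C gtr_pMr ?divr_gt0 // invf_lt1 // ltr1n.
Qed.

Lemma separation_upper (r C delta : R) :
  0 < delta -> 0 <= C -> 0 <= r ->
  (forall z, X z -> forall i N, exists p : int, forall t, (t < N)%N -> z (i + t%:Z) = x (p + t%:Z)) ->
  (forall n i j, (mismatches K c n i j)%:R <= C * r ^+ n) ->
  exists2 C', 0 <= C' & forall n nu, C' * (r / K%:R) ^+ n < nu ->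
    (Sep beta X delta nu <= (K ^ n * h)%N%:R%:E)%E.
Proof.
move=> d0 C0 r0 hX hD; have [L0 hL0] := shift_dist_ge A beta1 d0.
have K0 : 0 < K%:R :> R by rewrite ltr0n; lia.
exists ((2 * L0 + 1)%N%:R * C) => [|n nu hnu]; first by rewrite mulr_ge0.
pose Dm := Num.truncn (C * r ^+ n).
have hDm i j : (mismatches K c n i j <= Dm)%N by rewrite truncn_ge_nat // mulr_ge0 // exprn_ge0.
apply: (Sep_upper (P := in_class K h x n)) => [z /hX hz|m z z' hz hz'].
  exact: (in_class_exists K2 h0 n hz).
rewrite /dnu_separated => hs.
have hd := same_class_density R K2 h0 cE hDm hz hz' (L0 := L0)
  (e := fun l => delta <= shift_dist beta (shift_pow l z) (shift_pow l z')).
have := le_trans hs (hd _); rewrite lee_fin leNgt => /(_ _)/negP[].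
  by move=> l /hL0[u uL ne]; exists u => //; rewrite addrC.
apply: le_lt_trans hnu; rewrite natrM -!mulrA ler_wpM2l // expr_div_n mulrA natrX.
apply: ler_wpM2r; first by rewrite invr_ge0 exprn_ge0 // ler0n.
by rewrite truncn_le // mulr_ge0 // exprn_ge0.
Qed.
End SeparationOfSubshift.

(** * The discrepancy matrix *)

Section DiscrepancyMatrix.
Variables (R : realType) (B : finType) (K : nat) (sigma : B -> seq B) (c : int -> B).
Hypothesis K2 : (2 <= K)%N.
Hypothesis csigma : forall i, sigma (c i) = [seq c (child K 1 i t) | t <- iota 0 K].
Hypothesis csurj : forall b, exists i, c i = b.

Local Notation D := (mismatches K c).
Local Notation upair := {p : {set B} | #|p| == 2%N}.

Lemma sigma_substitutive : substitutive K c.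
Proof.
move=> i j t tK cij; have := csigma i; rewrite cij csigma.
move=> /(congr1 (fun s => nth (c 0) s t)).
by rewrite !(nth_map 0%N) ?size_iota // !nth_iota.
Qed.

Let csub := sigma_substitutive.

Lemma upair_indices (p : upair) : exists q : int * int, val p = [set c q.1; c q.2]%SET.
Proof.
have /cards2P[a [b [_ pE]]] := valP p.
by have [i ia] := csurj a; have [j jb] := csurj b; exists (i, j); rewrite pE ia jb.
Qed.

(** Mismatches are counted for positions, while the discrepancy acts on pairs of letters; positions
    are therefore chosen, and [pair_mismatchesE] shows that the choice is immaterial. *)
Definition pair_indices (p : upair) : int * int := projT1 (cid (upair_indices p)).

Lemma pair_indicesE p : val p = [set c (pair_indices p).1; c (pair_indices p).2]%SET.
Proof. exact: projT2 (cid (upair_indices p)). Qed.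

Definition pair_mismatches n (p : upair) : nat := D n (pair_indices p).1 (pair_indices p).2.

Lemma pair_mismatchesE n p i j : val p = [set c i; c j]%SET -> pair_mismatches n p = D n i j.
Proof.
rewrite pair_indicesE /pair_mismatches; set i' := _.1; set j' := _.2 => e.
have ne : c i' != c j' by have := valP p; rewrite pair_indicesE cards2; case: (_ != _).
have hi : c i' \in [set c i; c j]%SET by rewrite -e !inE eqxx.
have hj : c j' \in [set c i; c j]%SET by rewrite -e !inE eqxx orbT.
move: ne hi hj; rewrite !inE => ne /orP[] /eqP hi /orP[] /eqP hj.
- by rewrite hi hj eqxx in ne.
- exact: mismatches_eq.
- by rewrite mismatchesC; exact: mismatches_eq.
- by rewrite hi hj eqxx in ne.
Qed.

Lemma pair_mismatches0 p : pair_mismatches 0 p = 1%N.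
Proof.
rewrite /pair_mismatches mismatches0; have := valP p.
by rewrite pair_indicesE cards2; case: (_ != _).
Qed.

(** The children with equal letters, omitted by the discrepancy substitution, contribute no
    mismatches. Hence the counts obey the recursion of the incidence matrix. *)
Lemma pair_mismatchesS n p :
  pair_mismatches n.+1 p = (\sum_(q <- discrepancy sigma p) pair_mismatches n q)%N.
Proof.
rewrite (discrepancyE _ (pair_indicesE p)) /discrepancy_word !csigma.
rewrite /pair_mismatches mismatchesS; move: (pair_indices p) => [i j] /=.
rewrite zip_map big_pmap big_map -[X in iota 0 X]subn0 -/(index_iota 0 K) big_mkord.
apply: eq_bigr => t _ /=; case: insubP => [q _ qE|] /=.
  exact/esym/pair_mismatchesE.
by case: (eqVneq (c (child K 1 i t)) (c (child K 1 j t))) => [e|ne]; rewrite cards2 ?ne ?e ?eqxx // mismatches_eq0.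
Qed.

Lemma sum_count_mem (F : upair -> nat) (w : seq upair) :
  (\sum_(i < #|{: upair}|) F (enum_val i) * count_mem (enum_val i) w = \sum_(q <- w) F q)%N.
Proof.
elim: w => [|q w IH]; first by rewrite big_nil; apply: big1 => i _; rewrite muln0.
rewrite big_cons -IH (bigD1 (enum_rank q)) //= [in RHS](bigD1 (enum_rank q)) //=.
rewrite enum_rankK eqxx mulnDr muln1 addnA; congr addn.
apply: eq_bigr => i iq; rewrite (_ : (q == enum_val i) = false) //.
by apply: contraNF iq => /eqP->; rewrite enum_valK.
Qed.

Local Notation rho := (discrepancy_rate1 R sigma).

Let Dm (n : nat) (i : 'I_#|{: upair}|) : R := (pair_mismatches n (enum_val i))%:R.

Let DmS n j : Dm n.+1 j = \sum_i Dm n i * incidence_mx R (discrepancy sigma) i j.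
Proof.
rewrite /Dm pair_mismatchesS -sum_count_mem natr_sum; apply: eq_bigr => i _.
by rewrite mxE natrM.
Qed.

Lemma rate_lower : 0 < rho -> exists i j, forall n, rho ^+ n <= (D n i j)%:R.
Proof.
move=> rho0; have [||l hl] := spectral_radius_lower _ _ DmS rho0.
- by move=> i j; rewrite mxE.
- by move=> j; rewrite /Dm pair_mismatches0.
by exists (pair_indices (enum_val l)).1, (pair_indices (enum_val l)).2.
Qed.

Lemma rate_upper r : 0 < r -> rho < r ->
  exists2 C, 0 <= C & forall n i j, (D n i j)%:R <= C * r ^+ n.
Proof.
move=> r0 /(spectral_radius_upper DmS)[C C0 hC]; exists C => // n i j.
have [cij|cij] := eqVneq (c i) (c j).
  by rewrite mismatches_eq0 // mulr_ge0 // exprn_ge0 // ltW.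
have p2 : #|[set c i; c j]%SET| == 2%N by rewrite cards2 cij.
pose p : upair := Sub [set c i; c j]%SET p2.
have := hC n (enum_rank p); rewrite /Dm enum_rankK (@pair_mismatchesE _ _ i j) ?SubK //.
by rewrite ger0_norm.
Qed.
End DiscrepancyMatrix.

(** * Fixed points and height *)

Lemma expn_ge2 k j : (2 <= k)%N -> (0 < j)%N -> (2 <= k ^ j)%N.
Proof. by move=> k2 j0; rewrite (leq_trans k2) // -{1}(expn1 k) leq_pexp2l // ltnW. Qed.

Section FixedPoint.
Variables (A : finType) (k j h : nat) (phi : A -> seq A) (x : int -> A).
Hypotheses (k2 : (2 <= k)%N) (j0 : (0 < j)%N).
Hypotheses (phi_length : constant_length k phi) (phi_primitive : primitive phi).

Local Notation K := (k ^ j)%N.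
Local Notation psi := (subst_pow phi j).

Hypotheses (xfix : fixed_point K psi x) (xh : is_height K x h).

Let K2 : (2 <= K)%N := expn_ge2 k2 j0.

Let hK : constant_length K psi. Proof. exact: constant_length_pow. Qed.

Lemma fixed_point_child N i t : (t < K ^ N)%N ->
  x (child K N i t) = nth (x 0) (subst_pow psi N (x i)) t.
Proof.
elim: N t => [|N IH] t tN; first by move: tN; case: t => // _; rewrite child0.
have lt1 : (t %/ K < K ^ N)%N by rewrite ltn_divLR -?expnSr //; lia.
rewrite /subst_pow iterS (nth_subst_word _ hK); last first.
  by rewrite (size_iter _ _ hK) mul1n -expnSr.
rewrite -[iter N _ _]/(subst_pow psi N (x i)) -IH // -[in LHS](proj2 xfix) /subst_biinfinite.
have -> : child K N.+1 i t = (i * (K ^ N)%N%:Z) * K%:Z + t%:Z.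
  by rewrite /child expnSr PoszM mulrA.
by rewrite divzMDl ?modzMDl ?divz_nat ?modz_nat //; lia.
Qed.

Lemma fixed_point_substitutive : substitutive K x.
Proof. by move=> a b t tK ab; rewrite !fixed_point_child ?expn1 // ab. Qed.

Lemma subshift_pow z : subshift psi z -> subshift phi z.
Proof.
by move=> hz i n; have [a [m hm]] := hz i n; exists a, (m * j)%N; rewrite /subst_pow -iter_subst_pow.
Qed.

(** By primitivity all sufficiently high powers of [phi] bring, from any [b], the letter whose image
    contains the factor; the total exponent is made a multiple of [j]. *)
Lemma subshift_factor z : subshift phi z -> forall i n, exists M, forall b,
  infix (Defs.factor z i n) (subst_pow psi M b).
Proof.
move=> hz i n; have [a [m hm]] := hz i n; have [n0 hn0] := primitive_ge phi_primitive.
exists (m + n0)%N => b; rewrite [X in infix _ X]iter_subst_pow.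
have -> : ((m + n0) * j = m + ((m + n0) * j - m))%N by nia.
rewrite iterD; apply: infix_trans hm _; apply: infix_subst.
by rewrite infix1s; apply: hn0; nia.
Qed.

(** Every level-[M] block of [x] contains the factor, and a whole such block lies within [2 K^M]
    positions after [L]. *)
Lemma factor_occurs z : subshift phi z -> forall i n, exists V : nat, forall L : int,
  exists p : int, [/\ L <= p, p < L + V%:Z &
    forall r, (r < n)%N -> z (i + r%:Z) = x (p + r%:Z)].
Proof.
move=> /subshift_factor hz i n; have [M hM] := hz i n.
have KM : (0 < K ^ M)%N by rewrite expn_gt0; lia.
exists (2 * K ^ M)%N => L; pose s := (L %/ (K ^ M)%N%:Z)%Z + 1.
have := hM (x s) => /infixP[u [v uv]].
have sz : size (subst_pow psi M (x s)) = (size u + (n + size v))%N.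
  by rewrite uv !size_cat size_map size_iota.
rewrite (constant_length_pow M hK) in sz.
have [s1 s2] : L <= s * (K ^ M)%N%:Z /\ s * (K ^ M)%N%:Z <= L + (K ^ M)%N%:Z.
  have := divz_eq L (K ^ M)%N%:Z; have := @modz_ge0 L (K ^ M)%N%:Z.
  have := @ltz_pmod L (K ^ M)%N%:Z; rewrite /s mulrDl mul1r.
  by move: (_ * _) (_ %% _)%Z => e f; lia.
have p1 : L <= child K M s (size u) by rewrite /child; lia.
have p2 : child K M s (size u) + n%:Z <= L + (2 * K ^ M)%N%:Z by rewrite /child; lia.
(* An empty factor could be located at the very end of the block, where the strict bound on [p] may
   fail. *)
have [n0|n0] := posnP n.
  by exists L; split => // [|r]; [lia | rewrite n0].
exists (child K M s (size u)); split=> // [|r rn]; first by lia.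
have -> : child K M s (size u) + r%:Z = child K M s (size u + r).
  by rewrite /child PoszD addrA.
rewrite fixed_point_child ?uv; last by lia.
rewrite nth_cat ltnNge leq_addr /= addKn nth_cat size_map size_iota rn.
by rewrite (nth_map 0%N) ?size_iota // nth_iota.
Qed.

Let xX : subshift phi x. Proof. exact: subshift_pow (proj1 xfix). Qed.

Lemma fixed_point_recurrent i n : exists V : nat, forall L : int,
  exists d : int, [/\ L <= d, d < L + V%:Z &
    forall r, (r < n)%N -> x (i + r%:Z + d) = x (i + r%:Z)].
Proof.
have [V hV] := factor_occurs xX i n; exists V => L.
have [p [p1 p2 hp]] := hV (L + i); exists (p - i); split; [lia|lia|].
by move=> r rn; rewrite hp //; congr x; lia.
Qed.

Lemma shift_pow_subshift o : subshift phi (shift_pow o x).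
Proof.
move=> i n; have [a [m hm]] := xX (i + o) n; exists a, m.
rewrite (_ : Defs.factor _ _ _ = Defs.factor x (i + o) n) //.
by apply: eq_map => t; rewrite /shift_pow addrAC.
Qed.

Let h0 : (0 < h)%N. Proof. by case: xh => g _ [[]]. Qed.
Let hcop : coprime h K. Proof. by case: xh => g _ [[_ /eqP]]. Qed.

(** The height only controls positive return times to position [0]. Recurrence copies the letters at
    [0] and [m] to [d] and [m + d], both positive, and [m] is the difference. *)
Lemma height_dvd_return m : x 0 = x m -> (h%:Z %| m)%Z.
Proof.
move=> xm; pose i := Num.min 0 m.
have [V hV] := fixed_point_recurrent i (`|m|.+1).
have [d [d1 d2 hd]] := hV (1 - i).
have x0d : x 0 = x d.
  have := hd `|(- i)%R|%N; rewrite (_ : i + _ = 0) ?add0r; last by rewrite /i; lia.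
  by move=> -> //; rewrite /i; lia.
have xmd : x 0 = x (m + d).
  have := hd `|(m - i)%R|%N; rewrite (_ : i + _ = m); last by rewrite /i; lia.
  by move=> ->; rewrite // /i; lia.
have hdvd u : 1 <= u -> x 0 = x u -> (h%:Z %| u)%Z.
  case: xh => g [gS _] [[_ _ hg] _] u1 xu; rewrite /dvdz /=.
  by apply: dvdn_trans hg _; apply: gS; split; [lia | rewrite xu; congr x; lia].
have h1 := hdvd _ _ x0d; have h2 := hdvd _ _ xmd.
rewrite -(addrK d m) rpredB //; [apply: h2 | apply: h1]; rewrite /i in d1; lia.
Qed.

(** By primitivity the letter [x 0] occurs at the same offset below [a] and below [b]. The two
    occurrences differ by [(b - a) K^n], and [h] is coprime to [K]. *)
Lemma height_dvd a b : x a = x b -> (h%:Z %| b - a)%Z.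
Proof.
move=> xab; have [n _ hn] := primitive_pow j0 phi_primitive.
have /(nthP (x 0))[t] := hn (x a) (x 0).
rewrite (constant_length_pow n hK) => tn.
rewrite -fixed_point_child // => /esym xa.
have xb : x 0 = x (child K n b t).
  by rewrite xa; exact: (substitutive_iter K2 fixed_point_substitutive tn xab).
have : (h%:Z %| child K n b t - child K n a t)%Z.
  by rewrite rpredB //; apply: height_dvd_return.
have -> : child K n b t - child K n a t = (b - a) * (K ^ n)%N%:Z by rewrite /child; lia.
by rewrite Gauss_dvdzl // coprimezE !absz_nat coprimeXr.
Qed.

Lemma fixed_point_letter b : exists i, x i = b.
Proof.
have [n _ hn] := primitive_pow j0 phi_primitive.
have /(nthP (x 0))[t] := hn (x 0) b.
rewrite (constant_length_pow n hK) => tn tb; exists (child K n 0 t).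
by rewrite fixed_point_child.
Qed.

Section Blocks.
Variables (B : finType) (c : int -> B).
Hypothesis cE : forall i j, c i = c j <->
  forall r, (r < h)%N -> x (i * h%:Z + r%:Z) = x (j * h%:Z + r%:Z).

(** A displacement that returns a word of [x] is a multiple of [h] by [height_dvd], hence a
    displacement of whole blocks. *)
Lemma blocks_recurrent i l : exists V : nat, forall L : int, exists d : int,
  [/\ L <= d, d < L + V%:Z, c (i + d) = c i & c (l + d) = c l].
Proof.
pose m := Num.min i l.
have [V hV] := fixed_point_recurrent (m * h%:Z) ((`|i - l|.+1) * h).
exists V => L; have [d' [d1 d2 hd]] := hV (L * h%:Z).
have /dvdzP[d dE] : (h%:Z %| d')%Z.
  have := hd 0%N; rewrite muln_gt0 h0 addr0 => /(_ isT) /esym /height_dvd.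
  by rewrite addrC addKr.
subst d'; exists d.
have blk u : m <= u -> u <= m + `|i - l|%N%:Z -> c (u + d) = c u.
  move=> u1 u2; apply/cE => r rh.
  have [w wl ->] : exists2 w, (w <= `|(i - l)%R|)%N & u = m + w%:Z.
    by exists `|(u - m)%R|%N; lia.
  have -> : (m + w%:Z + d) * h%:Z + r%:Z = m * h%:Z + (w * h + r)%N%:Z + d * h%:Z.
    by rewrite PoszD PoszM; ring.
  rewrite hd; last by nia.
  by congr x; rewrite PoszD PoszM; ring.
split; [by nia | by nia | |]; apply: blk; rewrite /m; lia.
Qed.

(** The number [p h] is coprime to [K] and divides every return time of [x 0], so maximality of [h]
    forces [p = 1]. For a return time [m' h], the blocks at [0] and [m' K^h] agree because
    [h < K^h]; so [p] divides [m' K^h], hence [m']. *)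
Lemma blocks_height (y : int -> {set B}) :
  (forall i l, c i = c l -> y i = y l) ->
  forall p, coprime p K -> (forall m, (0 < m)%N -> y 0 = y m%:Z -> (p %| m)%N) -> p = 1%N.
Proof.
move=> yc p pK hp; have [g [gS gmax] [[_ _ hg] hmax]] := xh.
have p0 : (0 < p)%N.
  by case: p pK {hp} => //; rewrite /coprime gcd0n => /eqP K1; move: K2; rewrite K1.
suff : (p * h <= h)%N by rewrite -{2}[h]mul1n leq_pmul2r //; lia.
apply: hmax; split; first by rewrite muln_gt0 p0.
  by apply/eqP; rewrite -/(coprime _ _) coprimeMl pK hcop.
apply: gmax => m [m1 xm].
have /dvdnP[m' mE] : (h %| m)%N by apply: dvdn_trans hg _; exact: gS.
rewrite mE dvdn_pmul2r //.
have : (p %| m' * K ^ h)%N.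
  apply: hp; first by rewrite muln_gt0 expn_gt0; lia.
  apply: yc; apply/cE => r rh.
  have rK : (r < K ^ h)%N by apply: leq_trans rh (ltnW (ltn_expl h K2)).
  have := substitutive_iter K2 fixed_point_substitutive rK xm.
  by rewrite /child mul0r => ->; congr x; rewrite mE; lia.
by rewrite Gauss_dvdl // coprimeXr.
Qed.

End Blocks.
End FixedPoint.

(** * Amorphic complexity *)

Section LogarithmicLimits.
Variable R : realType.
Implicit Types (f : R -> \bar R) (a c e : R).

Lemma le_limf_einf_at_right f a :
  (forall s, s < a -> exists2 e, 0 < e & forall nu, 0 < nu -> nu < e -> (s%:E <= f nu)%E) ->
  (a%:E <= limf_einf f (at_right 0))%E.
Proof.
move=> hf; apply/lee_subgt0Pr => d d0; rewrite limf_einfE.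
have [|e e0 he] := hf (a - d); first by rewrite ltrBlDr ltrDl.
apply: le_ereal_sup_tmp; exists (ereal_inf (f @` [set nu | 0 < nu < e])).
  exists [set nu | 0 < nu < e] => //.
  near=> nu; rewrite /=; apply/andP; split; near: nu; [exact: nbhs_right_gt | exact: nbhs_right_lt].
by apply: le_ereal_inf_tmp => _ [nu /= /andP[nu0 nue] <-]; exact: he.
Unshelve. all: by end_near. Qed.

Lemma limf_esup_at_right_le f a :
  (forall s, a < s -> exists2 e, 0 < e & forall nu, 0 < nu -> nu < e -> (f nu <= s%:E)%E) ->
  (limf_esup f (at_right 0) <= a%:E)%E.
Proof.
move=> hf; apply/lee_addgt0Pr => d d0; rewrite limf_esupE.
have [|e e0 he] := hf (a + d); first by rewrite ltrDl.
apply: le_trans (ereal_inf_lbound _) _.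
  exists [set nu | 0 < nu < e]; last by [].
  near=> nu; rewrite /=; apply/andP; split; near: nu; [exact: nbhs_right_gt | exact: nbhs_right_lt].
by apply: ge_ereal_sup => _ [nu /= /andP[nu0 nue] <-]; exact: he.
Unshelve. all: by end_near. Qed.

Lemma limf_einf_le_esup f : (limf_einf f (at_right 0) <= limf_esup f (at_right 0))%E.
Proof.
rewrite limf_einfE limf_esupE; apply: ge_ereal_sup => _ [V FV <-].
apply: le_ereal_inf_tmp => _ [W FW <-].
have /filter_ex[z [Vz Wz]] : at_right 0 (V `&` W) by exact: filterI.
apply: (@le_trans _ _ (f z)); first by apply: ereal_inf_lbound; exists z.
by apply: ereal_sup_ubound; exists z.
Qed.

Lemma einf_affine f a c : (forall nu, 0 < nu -> nu < 1 -> (((a * (- ln nu) - c) / (- ln nu))%:E <= f nu)%E) ->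
  (a%:E <= limf_einf f (at_right 0))%E.
Proof.
move=> hf; apply: le_limf_einf_at_right => s sa.
(* Below this threshold [- ln nu] exceeds [c / (a - s)], so the constant [c] costs less than
   [a - s]. *)
exists (Num.min 1 (expR (- (c / (a - s))))); first by rewrite lt_min ltr01 expR_gt0.
move=> nu nu0; rewrite lt_min => /andP[nu1 nue]; apply: le_trans (hf _ nu0 nu1).
have t0 : 0 < - ln nu by rewrite oppr_gt0 ln_lt0 // nu0.
have : c / (a - s) < - ln nu.
  by rewrite ltrNr -(expRK (- (c / (a - s)))) ltr_ln // posrE expR_gt0.
rewrite ltr_pdivrMr ?subr_gt0 // lee_fin ler_pdivlMr //; lra.
Qed.

Lemma esup_affine f a c : (forall nu, 0 < nu -> nu < 1 -> (f nu <= ((a * (- ln nu) + c) / (- ln nu))%:E)%E) ->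
  (limf_esup f (at_right 0) <= a%:E)%E.
Proof.
move=> hf; apply: limf_esup_at_right_le => s sa.
exists (Num.min 1 (expR (- (c / (s - a))))); first by rewrite lt_min ltr01 expR_gt0.
move=> nu nu0; rewrite lt_min => /andP[nu1 nue]; apply: le_trans (hf _ nu0 nu1) _.
have t0 : 0 < - ln nu by rewrite oppr_gt0 ln_lt0 // nu0.
have : c / (s - a) < - ln nu.
  by rewrite ltrNr -(expRK (- (c / (s - a)))) ltr_ln // posrE expR_gt0.
rewrite ltr_pdivrMr ?subr_gt0 // lee_fin ler_pdivrMr //; lra.
Qed.
End LogarithmicLimits.

(** * From separation numbers to amorphic complexity *)

Section ComplexityFromSeparation.
Variables (R : realType) (A : finType) (beta rho : R) (X : set (int -> A)) (K h : nat).
Hypotheses (K2 : (2 <= K)%N) (h0 : (0 < h)%N) (rho0 : 0 <= rho) (rhoK : rho <= K%:R).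
Hypothesis X0 : X !=set0.
Hypothesis lower : 0 < rho -> exists2 C : R, 0 < C & forall n nu, 0 < nu ->
  nu <= C * (rho / K%:R) ^+ n -> ((K ^ n)%N%:R%:E <= Sep beta X 1 nu)%E.
Hypothesis upper : forall delta r : R, 0 < delta -> rho < r ->
  exists2 C, 0 <= C & forall n nu, C * (r / K%:R) ^+ n < nu ->
    (Sep beta X delta nu <= (K ^ n * h)%N%:R%:E)%E.

Local Notation V := ((ln K%:R)%:E / ((ln K%:R)%:E - lne rho%:E))%E.

Let K0 : 0 < K%:R :> R. Proof. by rewrite ltr0n; lia. Qed.
Let lnK : 0 < ln K%:R :> R. Proof. by rewrite ln_gt0 // ltr1n. Qed.

Lemma log_ratio_ge delta nu (N : nat) : 0 < nu -> nu < 1 -> (0 < N)%N ->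
  (N%:R%:E <= Sep beta X delta nu)%E -> ((ln N%:R / (- ln nu))%:E <= log_ratio beta X delta nu)%E.
Proof.
move=> nu0 nu1 N0 hN; have t0 : 0 < - ln nu by rewrite oppr_gt0 ln_lt0 // nu0.
rewrite /log_ratio inver gt_eqF // lee_pdivlMr // -EFinM divfK ?gt_eqF //.
rewrite -lne_EFin ?ltr0n // lee_lne // !in_itv /= leey andbT ?lee_fin //.
exact: le_trans hN.
Qed.

Lemma log_ratio_le delta nu (N : nat) : 0 < nu -> nu < 1 -> (0 < N)%N ->
  (Sep beta X delta nu <= N%:R%:E)%E -> (log_ratio beta X delta nu <= (ln N%:R / (- ln nu))%:E)%E.
Proof.
move=> nu0 nu1 N0 hN; have t0 : 0 < - ln nu by rewrite oppr_gt0 ln_lt0 // nu0.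
have [z Xz] := X0; have S1 := Sep_ge1 beta delta nu Xz.
rewrite /log_ratio inver gt_eqF // lee_pdivrMr // -EFinM divfK ?gt_eqF //.
rewrite -lne_EFin ?ltr0n // lee_lne // !in_itv /= leey andbT ?lee_fin //.
exact: le_trans S1.
Qed.

Lemma le_lower_ac a c :
  (forall nu, 0 < nu -> nu < 1 ->
     (((a * (- ln nu) - c) / (- ln nu))%:E <= log_ratio beta X 1 nu)%E) ->
  (a%:E <= lower_ac beta X)%E.
Proof.
move=> hac; apply: le_trans (einf_affine hac) _; apply: ereal_sup_ubound.
by exists 1 => /=.
Qed.

Lemma lower_ac_le_upper_ac : (lower_ac beta X <= upper_ac beta X)%E.
Proof.
apply: ge_ereal_sup => _ [d d0 <-]; apply: le_trans (limf_einf_le_esup _) _.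
by apply: ereal_sup_ubound; exists d.
Qed.

Lemma lower_ac_ge0 : (0 <= lower_ac beta X)%E.
Proof.
apply: (@le_lower_ac 0 0) => nu nu0 nu1; rewrite mul0r subr0 mul0r.
have [z Xz] := X0.
by have := @log_ratio_ge 1 nu 1 nu0 nu1 isT (Sep_ge1 beta 1 nu Xz); rewrite ln1 mul0r.
Qed.

(** For given [nu], the largest [n] with [nu <= C (rho/K)^n] is [- ln nu / (ln K - ln rho)] up to a
    bounded error, and there are at least [K^n] separated points. *)
Lemma lower_ac_geometric : 0 < rho -> rho < K%:R ->
  ((ln K%:R / (ln K%:R - ln rho))%:E <= lower_ac beta X)%E.
Proof.
move=> r0 rK; have [C C0 hC] := lower r0.
pose l := ln K%:R - ln rho.
have l0 : 0 < l by rewrite subr_gt0 ltr_ln.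
apply: (@le_lower_ac _ ((1 + `|ln C| / l) * ln K%:R)) => nu nu0 nu1.
have t0 : 0 < - ln nu by rewrite oppr_gt0 ln_lt0 // nu0.
have Cl : - (`|ln C| / l) <= ln C / l.
  by rewrite -mulNr ler_pM2r ?invr_gt0 // lerNl -normrN ler_norm.
(* If [nu > C], no level is admissible; the claimed bound is then at most [0], and one point
   suffices. *)
have [neg|pos] := ltP ((ln C - ln nu) / l) 0.
  apply: le_trans (_ : 0%:E <= _)%E.
    rewrite lee_fin pmulr_lle0 ?invr_gt0 //.
    have : ln K%:R / l * (- ln nu) - (1 + `|ln C| / l) * ln K%:R =
       ln K%:R * (- ln nu / l - 1 - `|ln C| / l) by field; rewrite gt_eqF.
    move=> ->; rewrite pmulr_rle0 //; move: neg; rewrite mulrBl mulNr; lra.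
  have [z Xz] := X0.
  by have := @log_ratio_ge 1 nu 1 nu0 nu1 isT (Sep_ge1 beta 1 nu Xz); rewrite ln1 mul0r.
pose n := Num.truncn ((ln C - ln nu) / l).
have n1 : n%:R <= (ln C - ln nu) / l by rewrite truncn_le.
have n2 : (ln C - ln nu) / l < n%:R + 1 by rewrite natr1; exact: truncnS_gt.
clearbody n.
have hn : nu <= C * (rho / K%:R) ^+ n.
  have rKn : 0 < (rho / K%:R) ^+ n by rewrite exprn_gt0 // divr_gt0.
  rewrite -ler_ln ?posrE ?mulr_gt0 // lnM ?posrE // lnXn ?divr_gt0 // ln_div ?posrE //.
  move: n1; rewrite ler_pdivlMr // /l -[_ *+ n]mulr_natl; lra.
have Kn : (0 < K ^ n)%N by rewrite expn_gt0 (ltnW K2).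
apply: le_trans (log_ratio_ge nu0 nu1 Kn (hC _ _ nu0 hn)).
rewrite lee_fin ler_pM2r ?invr_gt0 // natrX lnXn // -[_ *+ n]mulr_natl.
have -> : ln K%:R / l * (- ln nu) - (1 + `|ln C| / l) * ln K%:R =
   (- ln nu / l - 1 - `|ln C| / l) * ln K%:R by field; rewrite gt_eqF.
rewrite ler_pM2r //; move: n2; rewrite mulrBl mulNr; lra.
Qed.

(** Here [C (rho/K)^n = C] for all [n], so a fixed small [nu] allows arbitrarily large [K^n]. *)
Lemma lower_ac_infinite : rho = K%:R -> lower_ac beta X = +oo%E.
Proof.
move=> rK; have r0 : 0 < rho by rewrite rK.
have [C C0 hC] := lower r0.
apply/eqyP => a a0; apply: le_trans (ereal_sup_ubound _); last by exists 1; rewrite /= ?ltr01.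
apply: le_limf_einf_at_right => s sa; exists (Num.min 1 C); first by rewrite lt_min ltr01.
move=> nu nu0; rewrite lt_min => /andP[nu1 nuC].
have t0 : 0 < - ln nu by rewrite oppr_gt0 ln_lt0 // nu0.
pose n := (Num.truncn (s * (- ln nu) / ln K%:R)).+1.
have Kn : (0 < K ^ n)%N by rewrite expn_gt0 (ltnW K2).
have hn : nu <= C * (rho / K%:R) ^+ n by rewrite rK divff ?gt_eqF // expr1n mulr1 ltW.
apply: le_trans (log_ratio_ge nu0 nu1 Kn (hC _ _ nu0 hn)).
rewrite lee_fin ler_pdivlMr // natrX lnXn // -[_ *+ n]mulr_natl -ler_pdivrMr //.
exact/ltW/truncnS_gt.
Qed.

(** The number [r = K exp(- ln K / s)] is the solution of [ln K / (ln K - ln r) = s]. *)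
Lemma upper_ac_le s : 0 < s -> rho < K%:R * expR (- (ln K%:R / s)) -> (upper_ac beta X <= s%:E)%E.
Proof.
move=> s0 rs; apply: ge_ereal_sup => _ [delta d0 <-].
have [C C0 hC] := upper d0 rs.
(* [C] may be [0]; [C1] has a logarithm and makes the comparison strict. *)
pose C1 := C + 1; have C10 : 0 < C1 by rewrite ltr_wpDl.
pose l := ln K%:R / s; have l0 : 0 < l by rewrite divr_gt0.
apply: (@esup_affine _ _ _ ((`|ln C1| / l + 1) * ln K%:R + ln h%:R)) => nu nu0 nu1.
have t0 : 0 < - ln nu by rewrite oppr_gt0 ln_lt0 // nu0.
have q0 : 0 <= (`|ln C1| - ln nu) / l.
  by rewrite divr_ge0 ?(ltW l0) // addr_ge0 // ltW.
pose n := (Num.truncn ((`|ln C1| - ln nu) / l)).+1.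
have n1 : n%:R <= (`|ln C1| - ln nu) / l + 1 by rewrite /n -natr1 lerD2r truncn_le.
have n2 : (`|ln C1| - ln nu) / l < n%:R by exact: truncnS_gt.
clearbody n.
have hn : C * ((K%:R * expR (- (ln K%:R / s))) / K%:R) ^+ n < nu.
  rewrite mulrAC divff ?gt_eqF // mul1r -/l.
  apply: (@lt_le_trans _ _ (C1 * expR (- l) ^+ n)).
    by rewrite ltr_pM2r ?exprn_gt0 ?expR_gt0 // ltrDl.
  have e0 : 0 < expR (- l) ^+ n by rewrite exprn_gt0 // expR_gt0.
  rewrite -ler_ln ?posrE ?mulr_gt0 // lnM ?posrE // lnXn ?expR_gt0 // expRK -[_ *+ n]mulr_natl.
  by move: n2 (ler_norm (ln C1)); rewrite ltr_pdivrMr //; lra.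
have Kn : (0 < K ^ n * h)%N by rewrite muln_gt0 expn_gt0 h0 (ltnW K2).
apply: le_trans (log_ratio_le nu0 nu1 Kn (hC _ _ hn)) _.
rewrite lee_fin ler_pM2r ?invr_gt0 // natrM natrX lnM ?posrE ?exprn_gt0 // ?ltr0n //.
rewrite lnXn // -[_ *+ n]mulr_natl addrA lerD2r.
apply: le_trans (_ : ((`|ln C1| - ln nu) / l + 1) * ln K%:R <= _); first by rewrite ler_pM2r.
rewrite le_eqVlt; apply/orP; left; apply/eqP; rewrite /l; field.
by rewrite !gt_eqF.
Qed.

Lemma complexity_from_separation : has_amorphic_complexity beta X V.
Proof.
suff [h1 h2] : (V <= lower_ac beta X)%E /\ (upper_ac beta X <= V)%E.
  have h3 := lower_ac_le_upper_ac; split; apply/eqP; rewrite eq_le.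
    by rewrite h1 (le_trans h3 h2).
  by rewrite h2 (le_trans h1 h3).
have upper_le v : 0 <= v -> (forall s, v < s -> rho < K%:R * expR (- (ln K%:R / s))) ->
    (upper_ac beta X <= v%:E)%E.
  move=> v0 hv; apply/lee_addgt0Pr => d d0; rewrite -EFinD.
  have vd : v < v + d by rewrite ltrDl.
  by apply: upper_ac_le; [exact: le_lt_trans vd | exact: hv].
have [r0|r0] := eqVneq rho 0.
  have -> : V = 0%:E by rewrite r0 le0_lneNy //= ?lexx // invey mule0.
  split; first exact: lower_ac_ge0.
  by apply: upper_le => // s _; rewrite r0 mulr_gt0 // expR_gt0.
have rpos : 0 < rho by rewrite lt_neqAle eq_sym r0.
rewrite lne_EFin // -EFinB inver subr_eq0.
have [rK|rK] := eqVneq rho K%:R.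
  rewrite rK eqxx gt0_muley ?lte_fin // lower_ac_infinite //.
  by split => //; exact: leey.
have rltK : rho < K%:R by rewrite lt_neqAle rK.
have l0 : 0 < ln K%:R - ln rho by rewrite subr_gt0 ltr_ln.
rewrite ifF; last by apply/negbTE; rewrite -subr_eq0 gt_eqF.
rewrite -EFinM; split; first exact: lower_ac_geometric.
apply: upper_le => [|s vs]; first by rewrite divr_ge0 // ltW.
have s0 : 0 < s by apply: le_lt_trans vs; rewrite divr_ge0 // ltW.
rewrite -ltr_ln ?posrE ?mulr_gt0 ?expR_gt0 // lnM ?posrE ?expR_gt0 // expRK.
by move: vs; rewrite ltr_pdivrMr // mulrC -ltr_pdivrMr //; lra.
Qed.
End ComplexityFromSeparation.

(** * Amorphic complexity from a block coding of the fixed point *)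

Section BlockCoding.
Variables (R : realType) (A B : finType) (k j h : nat) (phi : A -> seq A) (x : int -> A).
Variables (beta : R) (sigma : B -> seq B) (c : int -> B).
Local Notation K := (k ^ j)%N.
Local Notation psi := (subst_pow phi j).
Hypotheses (k2 : (2 <= k)%N) (j0 : (0 < j)%N) (beta1 : 1 < beta).
Hypotheses (phi_length : constant_length k phi) (phi_primitive : primitive phi).
Hypotheses (xfix : fixed_point K psi x) (xh : is_height K x h).
Hypothesis cE : forall i j, c i = c j <->
  forall r, (r < h)%N -> x (i * h%:Z + r%:Z) = x (j * h%:Z + r%:Z).
Hypothesis csigma : forall i, sigma (c i) = [seq c (child K 1 i t) | t <- iota 0 K].
Hypothesis csurj : forall b, exists i, c i = b.

Local Notation rho := (discrepancy_rate1 R sigma).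

Let K2 : (2 <= K)%N := expn_ge2 k2 j0.

Let csub : substitutive K c := sigma_substitutive csigma.

Let h0 : (0 < h)%N. Proof. by case: xh => g _ [[]]. Qed.

Lemma rate_le_length : rho <= K%:R.
Proof.
have [r0|r0] := leP rho 0; first exact: le_trans r0 _.
have [i [l hil]] := rate_lower K2 csigma csurj r0.
by have := hil 1%N; rewrite expr1 => /le_trans; apply; rewrite ler_nat -[K in leqRHS]expn1 mismatches_leq.
Qed.

Lemma block_coding_lower : 0 < rho -> exists2 C : R, 0 < C & forall n nu, 0 < nu ->
  nu <= C * (rho / K%:R) ^+ n -> ((K ^ n)%N%:R%:E <= Sep beta (subshift phi) 1 nu)%E.
Proof.
move=> r0; have rK := rate_le_length.
have [i [l hil]] := rate_lower K2 csigma csurj r0.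
pose y := growth_class K c rho.
have yc a b : c a = c b -> y a = y b by exact: growth_class_eq.
have ysub : substitutive K y by exact: growth_class_substitutive.
have yrec a b : exists W : nat, forall L : int, exists d : int,
    [/\ L <= d, d < L + W%:Z, y (a + d) = y a & y (b + d) = y b].
  have [W hW] := blocks_recurrent k2 j0 phi_length phi_primitive xfix xh cE a b.
  by exists W => L; have [d [d1 d2 /yc d3 /yc d4]] := hW L; exists d.
have yper : forall p, (0 < p)%N -> ~ period y p.
  apply: (not_periodic K2 ysub).
  - by move=> a b; exact: growth_class_parent.
  - exact: (blocks_height k2 j0 phi_length xfix xh cE yc).
  - by exists i, l; exact: growth_class_neq.
have [W [J yshift]] := shift_mismatch K2 ysub yrec yper.
have K0 : 0 < K%:R :> R by rewrite ltr0n; lia.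
apply: (separation_lower K2 h0 beta1 cE r0 rK (kappa := K%:R ^- pair_depth K c) _ _ _ yshift).
- by rewrite invr_gt0 exprn_gt0.
- by move=> o; exact: (shift_pow_subshift xfix).
- by move=> n a b ne; exact: growth_class_lower.
Qed.

Lemma block_coding_upper (delta r : R) : 0 < delta -> rho < r ->
  exists2 C, 0 <= C & forall n nu, C * (r / K%:R) ^+ n < nu ->
    (Sep beta (subshift phi) delta nu <= (K ^ n * h)%N%:R%:E)%E.
Proof.
move=> d0 rr; have r0 : 0 < r by apply: le_lt_trans rr; exact: spectral_radius_ge0.
have [C C0 hC] := rate_upper K2 csigma csurj r0 rr.
apply: (separation_upper K2 h0 beta1 cE d0 C0 (ltW r0) _ hC) => z hz i n.
have [V hV] := factor_occurs k2 j0 phi_length phi_primitive xfix hz i n.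
by have [p [_ _ hp]] := hV 0; exists p.
Qed.

Lemma block_coding_complexity : has_amorphic_complexity beta (subshift phi)
  ((ln K%:R)%:E / ((ln K%:R)%:E - lne rho%:E))%E.
Proof.
apply: (complexity_from_separation K2 h0 _ rate_le_length _ block_coding_lower block_coding_upper).
  exact: spectral_radius_ge0.
by exists x; exact: (subshift_pow (proj1 xfix)).
Qed.
End BlockCoding.

Lemma discrepancy_rate_complexity (R : realType) (A : finType) (k j h : nat)
    (phi : A -> seq A) (x : int -> A) (beta : R) :
  (2 <= k)%N -> (0 < j)%N -> 1 < beta -> constant_length k phi -> primitive phi ->
  fixed_point (k ^ j) (subst_pow phi j) x -> is_height (k ^ j) x h ->
  has_amorphic_complexity beta (subshift phi)
    ((ln (k ^ j)%N%:R)%:E / ((ln (k ^ j)%N%:R)%:E -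
      lne (discrepancy_rate_at R (k ^ j) (subst_pow phi j) x h)%:E))%E.
Proof.
move=> k2 j0 beta1 hk hp xfix xh.
have K2 := expn_ge2 k2 j0.
have hK := constant_length_pow j hk.
rewrite /discrepancy_rate_at; case: (eqVneq h 1%N) => [h1|h1].
  (* For height [1] each letter is its own block; for larger height the coding is by the letters of
     the pure base. *)
  apply: (block_coding_complexity k2 j0 beta1 hk hp xfix xh (c := x)).
  - move=> a b; rewrite h1; split=> [ab [|//] _|/(_ 0%N isT)]; rewrite !mulr1 !addr0 //.
  - move=> a; apply: (@eq_from_nth _ (x 0)); rewrite hK ?size_map ?size_iota // => t tK.
    rewrite (nth_map 0%N) ?size_iota // nth_iota // add0n.
    rewrite (fixed_point_child k2 j0 hk xfix) ?expn1 //.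
    by rewrite /subst_pow iter_subst_pow mul1n.
  - by move=> b; exact: (fixed_point_letter k2 j0 hk hp xfix).
have bP i : block x h i \in base_alphabet x h by rewrite inE; apply/asboolP; exists i.
pose c i : {w | w \in base_alphabet x h} := exist _ (block x h i) (bP i).
apply: (block_coding_complexity k2 j0 beta1 hk hp xfix xh (c := c)).
- move=> a b; split=> [/(congr1 val) /= e r rh|e].
    by have := congr1 (fun w => tnth w (Ordinal rh)) e; rewrite !tnth_mktuple.
  by apply: val_inj => /=; apply: eq_from_tnth => r; rewrite !tnth_mktuple e.
- move=> a; apply: (inj_map val_inj).
  rewrite (@pure_baseE _ _ _ _ _ a _ (ltnW K2) hK (proj2 xfix)) // -map_comp.
  by apply: eq_map => t /=; rewrite /child expn1.
- move=> b; have := valP b; rewrite inE => /asboolP[i bi]; exists i.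
  exact/val_inj/esym.
Qed.

(** Passing from [phi] to [phi^j] multiplies numerator and denominator by [j]; the values [0] and
    [+oo] of the quotient are preserved as well. *)
Lemma root_rate_formula (R : realType) (k j : nat) (rho : R) : (2 <= k)%N -> (0 < j)%N -> 0 <= rho ->
  ((ln k%:R)%:E / ((ln k%:R)%:E - lne (rho `^ j%:R^-1)%:E) =
   (ln (k ^ j)%N%:R)%:E / ((ln (k ^ j)%N%:R)%:E - lne rho%:E))%E.
Proof.
move=> k2 j0 rho0; have k0 : 0 < k%:R :> R by rewrite ltr0n; lia.
have lnk : 0 < ln k%:R :> R by rewrite ln_gt0 // ltr1n.
have j0' : 0 < j%:R :> R by rewrite ltr0n.
have [->|r0] := eqVneq rho 0.
  by rewrite powR0 ?invr_eq0 ?gt_eqF // le0_lneNy //= invey !mule0.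
have rpos : 0 < rho by rewrite lt_neqAle eq_sym r0.
rewrite !lne_EFin ?powR_gt0 // ln_powR natrX lnXn // -!EFinB -[ln _ *+ j]mulr_natl !inver.
have -> : j%:R * ln k%:R - ln rho = j%:R * (ln k%:R - j%:R^-1 * ln rho).
  by field; rewrite gt_eqF.
rewrite mulf_eq0 (gt_eqF j0') /=; case: (eqVneq (ln k%:R - j%:R^-1 * ln rho) 0) => [_|ne].
  by rewrite !gt0_muley ?lte_fin ?mulr_gt0.
by rewrite -!EFinM; congr (_%:E); rewrite invfM mulrACA divff ?mul1r ?gt_eqF.
Qed.

Theorem theorem2 (R : realType) (A : finType) (k : nat) (phi : A -> seq A)
  (lam beta : R)
  (k_ge2 : (2 <= k)%N)
  (phi_length : constant_length k phi)
  (phi_primitive : primitive phi)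
  (lam_rate : is_discrepancy_rate k phi lam)
  (beta_gt1 : 1 < beta) :
  has_amorphic_complexity beta (subshift phi)
    ((ln k%:R)%:E / ((ln k%:R)%:E - lne lam%:E))%E.

Proof.
case: lam_rate => j [x [h [j0 _ xfix xh ->]]].
rewrite root_rate_formula //.
  exact: discrepancy_rate_complexity.
by rewrite /discrepancy_rate_at; case: ifP => _; exact: spectral_radius_ge0.
Qed.
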